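(* Let $d\ge 1$, $\alpha\in(0,2)$, $\beta\in(0,1)$ with $\alpha+\beta$ not an integer. Let $A:\mathbb{R}^d\times\mathbb{R}^d\to\mathbb{R}$ be measurable and suppose there are positive finite constants $a_1,a_2,a_3$ such that $a_1\le A(x,h)\le a_2$ for all $x,h\in\mathbb{R}^d$ and $\sup_x\sup_h|A(x+k,h)-A(x,h)|\le a_3|k|^\beta$ for all $k\in\mathbb{R}^d$. Let $\mathcal{L}$ be the operator $$\mathcal{L}u(x)=\int_{\mathbb{R}^d\setminus\{0\}}[u(x+h)-u(x)-1_{(|h|\le 1)}\nabla u(x)\cdot h]\,\frac{A(x,h)}{|h|^{d+\alpha}}\,dh\quad\text{if }\alpha\in[1,2),$$ $$\mathcal{L}u(x)=\int_{\mathbb{R}^d\setminus\{0\}}[u(x+h)-u(x)]\,\frac{A(x,h)}{|h|^{d+\alpha}}\,dh\quad\text{if }\alpha\in(0,1).$$ Let $P:\mathbb{R}^d\to\mathbb{R}$ satisfy $\|P\|_{C^\beta}<\infty$ and set $\mathcal{L}'u(x)=\mathcal{L}u(x)+P(x)u(x)$. Then there exists a constant $c_1$ (which depends on $\|P\|_{C^\beta}$ but not on $u$ or $f$) such that if $\|u\|_{C^{\alpha+\beta}}<\infty$ and $\mathcal{L}'u=f$ on $\mathbb{R}^d$, then $$\|u\|_{C^{\alpha+\beta}}\le c_1\big(\|u\|_{L^\infty}+\|f\|_{C^\beta}\big).$$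
   Context: For non-integer $\gamma>0$ let $m$ be the largest integer less than $\gamma$. For $\theta\in(0,1)$, $[g]_{C^\theta}=\sup_{x\in\mathbb{R}^d}\sup_{|h|>0}|g(x+h)-g(x)|/|h|^\theta$. The Hölder norm is $\|g\|_{C^\gamma}=\|g\|_{L^\infty}+\sum_{j_1,\dots,j_m=1}^d[D_{j_1\cdots j_m}g]_{C^{\gamma-m}}$ (for $m=0$: $\|g\|_{L^\infty}+[g]_{C^\gamma}$), where $D_{j_1\cdots j_m}$ denotes the iterated partial derivative; $C^\gamma=C^\gamma(\mathbb{R}^d)$ is the set of ($m$ times differentiable) $g:\mathbb{R}^d\to\mathbb{R}$ with $\|g\|_{C^\gamma}<\infty$. For $u\in C^{\alpha+\beta}$ the integrals defining $\mathcal{L}u$ converge absolutely. *)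

(* Defs.v *)
From HB Require Import structures.
From mathcomp Require Import all_boot all_order all_algebra.
From mathcomp Require Import all_classical all_reals all_analysis.

Set Implicit Arguments.
Unset Strict Implicit.
Unset Printing Implicit Defensive.

Import Order.TTheory GRing.Theory Num.Theory.
Import numFieldNormedType.Exports.

Local Open Scope classical_set_scope.
Local Open Scope ring_scope.

Definition measure_rV_display : measure_display -> measure_display.
Proof. exact. Qed.

(* R^n is 'rV[R]_n with the sigma-algebra generated by its coordinates (the
   Borel sigma-algebra), as the library does for n.-tuple. *)
Section measurable_rV.
Context {R : realType}.
Variable n : nat.

Let coors : 'I_n -> 'rV[R]_n -> measurableTypeR R := fun i x => x ord0 i.

Let rV_set0 : g_sigma_preimage coors set0.
Proof. exact: sigma_algebra0. Qed.

Let rV_setC A : g_sigma_preimage coors A -> g_sigma_preimage coors (~` A).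
Proof. exact: sigma_algebraC. Qed.

Let rV_bigcup (F : _^nat) : (forall i, g_sigma_preimage coors (F i)) ->
  g_sigma_preimage coors (\bigcup_i (F i)).
Proof. exact: sigma_algebra_bigcup. Qed.

HB.instance Definition _ :=
  @isMeasurable.Build (measure_rV_display default_measure_display)
    'rV[R]_n (g_sigma_preimage coors) rV_set0 rV_setC rV_bigcup.

End measurable_rV.

Section measurable_rV_coord.
Context {R : realType}.

Lemma measurable_rV_coord n (i : 'I_n) :
  measurable_fun [set: 'rV[R]_n]
    (fun x : 'rV[R]_n => x ord0 i : measurableTypeR R).
Proof.
move=> _ Y mY; rewrite setTI; apply: sub_sigma_algebra => /=.
rewrite -bigcup_seq/=; exists i => /=; first by rewrite mem_index_enum.
by exists Y => //; rewrite setTI.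
Qed.

Lemma measurable_fun_rVP d (T : measurableType d) n (f : T -> 'rV[R]_n) :
  (forall i, measurable_fun [set: T] (fun t => f t ord0 i : measurableTypeR R)) ->
  measurable_fun [set: T] f.
Proof.
move=> mf; suff : g_sigma_preimage
    (fun i : 'I_n => (fun x : 'rV[R]_n => x ord0 i : measurableTypeR R) \o f)
    `<=` measurable.
  rewrite g_sigma_preimage_comp => prefS.
  by move=> _ A mA; apply: prefS; exists A.
apply: smallest_sub; first exact: sigma_algebra_measurable.
move=> B; rewrite -bigcup_seq/= => -[i _ [A mA <-]].
exact: (mf i measurableT).
Qed.

Definition rV_cons n (p : measurableTypeR R * 'rV[R]_n) : 'rV[R]_n.+1 :=
  \row_j oapp (p.2 ord0) p.1 (unlift ord0 j).

Definition rV_uncons n (x : 'rV[R]_n.+1) : measurableTypeR R * 'rV[R]_n :=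
  (x ord0 ord0, \row_j x ord0 (lift ord0 j)).

Lemma rV_consK n : cancel (@rV_cons n) (@rV_uncons n).
Proof.
move=> [r v]; rewrite /rV_uncons !mxE unlift_none/=; congr pair.
by apply/rowP => j; rewrite !mxE liftK.
Qed.

Lemma measurable_rV_cons n : measurable_fun setT (@rV_cons n).
Proof.
apply: measurable_fun_rVP => i; case: (unliftP ord0 i) => [j|] ->.
  under eq_fun do rewrite mxE liftK/=.
  exact: measurableT_comp (measurable_rV_coord j) measurable_snd.
under eq_fun do rewrite mxE unlift_none/=.
exact: measurable_fst.
Qed.

Lemma measurable_rV_uncons n : measurable_fun setT (@rV_uncons n).
Proof.
apply/measurable_fun_pairP; split; first exact: measurable_rV_coord.
apply: measurable_fun_rVP => i; under eq_fun do rewrite mxE.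
exact: measurable_rV_coord.
Qed.

End measurable_rV_coord.

(* The image of (lebesgue_measure \x mu) in R^(n+1). *)
Section lebesgue_rV_step.
Context {R : realType}.
Variables (n : nat) (mu : {sigma_finite_measure set 'rV[R]_n -> \bar R}).
Local Open Scope ereal_scope.

Definition lebesgue_rV_step : set 'rV[R]_n.+1 -> \bar R :=
  pushforward (@lebesgue_measure R \x mu) (@rV_cons R n).

Let step0 : lebesgue_rV_step set0 = 0.
Proof. by rewrite /lebesgue_rV_step /pushforward preimage_set0 measure0. Qed.

Let step_ge0 A : 0 <= lebesgue_rV_step A.
Proof. by rewrite /lebesgue_rV_step /pushforward; exact: measure_ge0. Qed.

Let step_sigma_additive : semi_sigma_additive lebesgue_rV_step.
Proof.
move=> F mF tF mUF; rewrite /lebesgue_rV_step /pushforward preimage_bigcup.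
apply: measure_semi_sigma_additive.
- by move=> k; rewrite -[X in measurable X]setTI; exact: measurable_rV_cons.
- apply/trivIsetP => /= i j _ _ ij; rewrite -preimage_setI.
  by move/trivIsetP : tF => /(_ _ _ _ _ ij) ->//; rewrite preimage_set0.
- by rewrite -preimage_bigcup -[X in measurable X]setTI;
    exact: measurable_rV_cons.
Qed.

HB.instance Definition _ := isMeasure.Build _ _ _
  lebesgue_rV_step step0 step_ge0 step_sigma_additive.

Let step_sigma_finite : sigma_finite setT lebesgue_rV_step.
Proof.
have /sigma_finiteP[F [TF ndF Foo]] := sigma_finiteT (@lebesgue_measure R).
have /sigma_finiteP[G [TG ndG Goo]] := sigma_finiteT mu.
exists (fun k => @rV_uncons R n @^-1` (F k `*` G k)).
  rewrite -preimage_bigcup (_ : \bigcup_k _ = setT) ?preimage_setT//.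
  apply/seteqP; split => // -[x y] _.
  have [k _ Fkx] : (\bigcup_k F k) x by rewrite -TF.
  have [l _ Gly] : (\bigcup_k G k) y by rewrite -TG.
  exists (maxn k l) => //; split => /=.
  - by move: x Fkx; exact/subsetPset/ndF/leq_maxl.
  - by move: y Gly; exact/subsetPset/ndG/leq_maxr.
move=> k; have [mF Fk] := Foo k; have [mG Gk] := Goo k; split.
  rewrite -[X in measurable X]setTI; apply: measurable_rV_uncons => //.
  exact: measurableX.
rewrite /lebesgue_rV_step /pushforward -comp_preimage.
rewrite (_ : @rV_uncons R n \o @rV_cons R n = id); last first.
  by apply/funext => x /=; rewrite rV_consK.
by rewrite preimage_id product_measure1E// lte_mul_pinfty// ge0_fin_numE.
Qed.

HB.instance Definition _ := Measure_isSigmaFinite.Build _ _ _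
  lebesgue_rV_step step_sigma_finite.

End lebesgue_rV_step.

(* Lebesgue measure on R^n. *)
Fixpoint lebesgue_rV (R : realType) (n : nat) :
    {sigma_finite_measure set 'rV[R]_n -> \bar R} :=
  match n with
  | 0%N => \d_(0 : 'rV[R]_0)
  | n'.+1 => lebesgue_rV_step (lebesgue_rV R n')
  end.

Lemma lebesgue_rV_box (R : realType) n (A : 'I_n -> set (measurableTypeR R)) :
  (forall i, measurable (A i)) ->
  (lebesgue_rV R n [set x | forall i, A i (x ord0 i)] =
   \prod_(i < n) lebesgue_measure (A i))%E.
Proof.
elim: n A => [|n IH] A mA.
  by rewrite big_ord0 /= diracE mem_set// => -[].
rewrite big_ord_recl -IH; last by move=> i; exact: mA.
have mB : measurable [set v : 'rV[R]_n | forall i, A (lift ord0 i) (v ord0 i)].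
  rewrite (_ : [set v | _] = \bigcap_(i : 'I_n)
      (fun x : 'rV[R]_n => x ord0 i : measurableTypeR R) @^-1` A (lift ord0 i)).
    apply: fin_bigcap_measurable => // i _.
    by rewrite -[X in measurable X]setTI; exact: measurable_rV_coord.
  by apply/seteqP; split => x /= h i; [move=> _; exact: h|exact: (h i Logic.I)].
rewrite /= /lebesgue_rV_step /pushforward.
rewrite -(product_measure1E _ _ (mA ord0) mB).
congr (_ _); apply/seteqP; split => -[r v] /=.
  move=> h; split; first by have := h ord0; rewrite mxE unlift_none.
  by move=> i; have := h (lift ord0 i); rewrite mxE liftK.
move=> [hr hv] i; rewrite mxE.
by case: (unliftP ord0 i) => [j|] ->; rewrite ?liftK ?unlift_none//; exact: hv.
Qed.

Section holder.
Context {R : realType} {d : nat}.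
Implicit Types (g u : 'rV[R]_d -> R) (x h : 'rV[R]_d).

(* The library norm `|h| on 'rV[R]_d is the max norm. *)
Definition enorm h : R := Num.sqrt (\sum_i h ord0 i ^+ 2).

Definition partial (i : 'I_d) g : 'rV[R]_d -> R :=
  fun x => 'D_(delta_mx ord0 i) g x.

Definition iter_partial (j : seq 'I_d) g : 'rV[R]_d -> R := foldr partial g j.

(* Directional derivatives are total functions in the library, so that
   differentiability has to be required separately. *)
Fixpoint times_differentiable (m : nat) g : Prop :=
  match m with
  | 0%N => True
  | m'.+1 => (forall x, differentiable g x) /\
             (forall i, times_differentiable m' (partial i g))
  end.

Definition Linfty_norm g : \bar R := 'N[lebesgue_rV R d]_+oo[EFin \o g]%E.

Definition holder_seminorm (theta : R) g : \bar R :=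
  ereal_sup [set ereal_sup
    [set (`|g (x + h) - g x| / enorm h `^ theta)%:E | h in [set h | h != 0]]
    | x in [set: 'rV[R]_d]].

(* For a positive non-integer gamma, Num.truncn gamma is the largest integer
   less than gamma. *)
Definition holder_norm (gamma : R) g : \bar R :=
  let m := Num.truncn gamma in
  (Linfty_norm g +
   \sum_(j : m.-tuple 'I_d) holder_seminorm (gamma - m%:R) (iter_partial j g))%E.

Definition holder_space (gamma : R) : set ('rV[R]_d -> R) :=
  [set g | times_differentiable (Num.truncn gamma) g /\
           (holder_norm gamma g < +oo)%E].

Definition grad_dot u x h : R := \sum_i partial i u x * h ord0 i.

Definition stable_like_op (alpha : R) (A : 'rV[R]_d -> 'rV[R]_d -> R) u x : R :=
  if 1 <= alpha then
    \int[lebesgue_rV R d]_(h in [set h | h != 0])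
      ((u (x + h) - u x - (enorm h <= 1)%R%:R * grad_dot u x h)
       * (A x h / enorm h `^ (d%:R + alpha)))
  else
    \int[lebesgue_rV R d]_(h in [set h | h != 0])
      ((u (x + h) - u x) * (A x h / enorm h `^ (d%:R + alpha))).

End holder.

(* Main.v *)
Require Import Defs.
From HB Require Import structures.
From mathcomp Require Import all_boot all_order all_algebra.
From mathcomp Require Import all_classical all_reals all_analysis.
From mathcomp Require Import measurable_realfun ess_sup_inf.
From mathcomp Require Import zify ring lra.
Set Implicit Arguments.
Unset Strict Implicit.
Unset Printing Implicit Defensive.
Import Order.TTheory GRing.Theory Num.Theory.
Import numFieldNormedType.Exports.
Local Open Scope classical_set_scope.
Local Open Scope ring_scope.

(** Why the estimate holds.

    Put [gam = alpha + beta], let [m] be the integer part of [gam] and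
    [N = m + 1], and let [Z] be the best constant for which all mixed
    differences of order [N] of [u] with increments of size at most [t] are
    bounded by [Z * t `^ gam].  Differences commute with the derivatives, and
    Marchaud's inequality at the critical exponent bounds the Hoelder
    seminorms of the derivatives of order [m] by a multiple of [Z]
    ([holder_seminorm_fdiffs]).  Hence only [Z] has to be estimated, and this
    is done by a maximum principle, without semigroups, Fourier analysis or
    localisation.

    Choose increments [ks] of size at most [r] for which the difference
    [v = fdiffs ks u] (up to sign) has a supremum close to [Z * r `^ gam].
    Doubling all the increments gives a difference which is at most
    [2 `^ gam * Z * r `^ gam] and is the sum of [2 ^ N] translates of [v].
    Since [gam < N], near any point [x0] where [v] almost attains its supremum
    there is, at a distance comparable to [r], a point where [v] is smaller
    than [v x0] by a fixed fraction of [Z * r `^ gam] ([exists_low_fdiffs]),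
    and by Marchaud's inequality this persists on a cube of size comparable to
    [r] ([fdiffs_equicontinuous]).  The kernel has mass at least a multiple of
    [r `^ - alpha] on this cube, and the increments of [v] at [x0] have almost
    no positive part ([near_maximum]), so the operator with coefficients
    frozen at [x0], applied to [v], is at most
    [- c * Z * r `^ gam * r `^ - alpha = - c * Z * r `^ beta].

    That same quantity is the difference along [ks], at [x0], of the frozen
    operator applied to [u].  Replacing the frozen coefficients by the actual
    ones costs [r `^ beta] times the size of the integrands, because [A] is
    Hoelder in its first variable; the actual operator gives [f - P * u], whose
    difference is [O (r `^ beta)].  The powers of [r] cancel and
    [Z <= C * ([f] + [P * u] + I)], with Hoelder seminorms of exponent [beta]
    and [I] the size of the integrands ([fdiffs_estimate]).  By interpolation
    ([increment_interpolation]) the last two terms are at most a small multiple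
    of [Z] plus a multiple of the supremum of [u]; absorbing the former
    concludes ([schauder_estimate]). *)

(** * Iterated finite differences *)

Section finite_differences.
Context {R : realType} {V : normedModType R}.
Implicit Types (g u : V -> R) (k x y : V) (ks : seq V).

Definition fdiff k g : V -> R := fun x => g (x + k) - g x.

Definition fdiffs ks g : V -> R := foldr fdiff g ks.

Definition bounded_by (t : R) ks := all (fun k => `|k| <= t) ks.

Definition fdiffs_bounded (n : nat) (t B : R) g :=
  forall ks x, size ks = n -> bounded_by t ks -> `|fdiffs ks g x| <= B.

Lemma fdiffC k l g : fdiff k (fdiff l g) = fdiff l (fdiff k g).
Proof.
apply/funext => x; rewrite /fdiff -!addrA (addrC k l).
by ring.
Qed.

Lemma fdiffs_fdiff ks k g : fdiffs ks (fdiff k g) = fdiff k (fdiffs ks g).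
Proof. by elim: ks => //= l ks ->; rewrite fdiffC. Qed.

Lemma fdiffs_cat ks ls g : fdiffs (ks ++ ls) g = fdiffs ks (fdiffs ls g).
Proof. exact: foldr_cat. Qed.

Lemma fdiffsN ks g : fdiffs ks (fun x => - g x) = fun x => - fdiffs ks g x.
Proof. by elim: ks => //= k ks ->; apply/funext => x; rewrite /fdiff; ring. Qed.

Lemma fdiffsD ks g1 g2 :
  fdiffs ks (fun x => g1 x + g2 x) = fun x => fdiffs ks g1 x + fdiffs ks g2 x.
Proof. by elim: ks => //= k ks ->; apply/funext => x; rewrite /fdiff; ring. Qed.

Lemma fdiffsZ ks (c : R) g :
  fdiffs ks (fun x => c * g x) = fun x => c * fdiffs ks g x.
Proof. by elim: ks => //= k ks ->; apply/funext => x; rewrite /fdiff; ring. Qed.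

Lemma fdiffs_shift ks g h :
  fdiffs ks (fun x => g (x + h)) = fun x => fdiffs ks g (x + h).
Proof.
by elim: ks => //= k ks ->; apply/funext => x; rewrite /fdiff addrAC.
Qed.

Lemma bounded_by_le t t' ks : t <= t' -> bounded_by t ks -> bounded_by t' ks.
Proof. by move=> tt' /allP h; apply/allP => k /h /le_trans; apply. Qed.

Lemma bounded_by_cat t ks ls : bounded_by t (ks ++ ls) = bounded_by t ks && bounded_by t ls.
Proof. exact: all_cat. Qed.

Lemma bounded_by_double t ks :
  bounded_by t ks -> bounded_by (2 * t) [seq 2 *: k | k <- ks].
Proof.
move=> /allP h; apply/allP => _ /mapP[k /h kt ->].
by rewrite normrZ ger0_norm// ler_pM2l.
Qed.

(** Only the points at distance at most [size ks * t] enter the difference,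
    so that a local bound on [g] suffices; it will be applied to functions
    that are small near [x] only. *)
Lemma fdiffs_le ks g x (t B : R) : 0 <= t -> bounded_by t ks ->
  (forall y, `|y| <= (size ks)%:R * t -> `|g (x + y)| <= B) ->
  `|fdiffs ks g x| <= 2 ^+ size ks * B.
Proof.
move=> t0; elim: ks x => [|k ks IH] x /=.
  by move=> _ /(_ 0); rewrite addr0 normr0 mul0r lexx mul1r; apply.
case/andP => kt wks gB.
have h z : `|z| <= t -> `|fdiffs ks g (x + z)| <= 2 ^+ size ks * B.
  move=> zt; apply: IH => // y yB; rewrite -addrA; apply: gB.
  rewrite (le_trans (ler_normD _ _))// -natr1 mulrDl mul1r addrC lerD//.
rewrite exprS -mulrA mulr2n mulrDl !mul1r /fdiff.
rewrite (le_trans (ler_normB _ _))// lerD ?h//.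
by rewrite -[x in fdiffs _ _ x]addr0 h// normr0.
Qed.

Lemma fdiffs_bounded_le n m t B g :
  fdiffs_bounded n t B g -> fdiffs_bounded (m + n) t (2 ^+ m * B) g.
Proof.
move=> h ks x sks wks; rewrite -[ks](cat_take_drop m) fdiffs_cat.
have sm : size (take m ks) = m by rewrite size_take sks; case: ltnP => //; lia.
have := wks; rewrite -[ks in bounded_by _ ks](cat_take_drop m) bounded_by_cat.
case/andP => w1 w2; rewrite -[X in 2 ^+ X]sm.
have [t0|t0] := leP 0 t.
  apply: (@fdiffs_le _ _ _ t) => // y _; apply: h => //.
  by rewrite size_drop sks; lia.
case: m h sks sm w1 {w2} => [|m] h sks sm w1.
  by rewrite take0 drop0 /= expr0 mul1r; apply: h.
case: (take m.+1 ks) w1 sm => [//|k ks'] /= /andP[kt _] _.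
by have := le_lt_trans (le_trans (normr_ge0 _) kt) t0; rewrite ltxx.
Qed.

Lemma fdiffs_bounded_sup n t B g :
  (forall x, `|g x| <= B) -> fdiffs_bounded n t (2 ^+ n * B) g.
Proof.
move=> h; rewrite -[n in fdiffs_bounded n]addn0; apply: fdiffs_bounded_le.
by case=> // x _ _; apply: h.
Qed.

Lemma fdiffs_bounded_ge0 n t B g : 0 <= t -> fdiffs_bounded n t B g -> 0 <= B.
Proof.
move=> t0 /(_ (nseq n 0) 0); rewrite size_nseq => /(_ erefl) gB.
apply: le_trans (gB _) => //.
by apply/allP => y /nseqP[-> _]; rewrite normr0.
Qed.

Lemma fdiffs_bounded_fdiff n t B g k :
  fdiffs_bounded n.+1 t B g -> `|k| <= t -> fdiffs_bounded n t B (fdiff k g).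
Proof.
by move=> h kt ks x sks wks; rewrite fdiffs_fdiff; apply: (h (k :: ks));
  rewrite /= ?sks// kt.
Qed.

Lemma fdiff_double k g x :
  fdiff (2 *: k) g x = fdiff k g x + fdiff k g (x + k).
Proof. by rewrite /fdiff scaler_nat mulr2n addrA; ring. Qed.

(** Each doubled difference is the sum of the difference at two points, so
    doubling all the increments averages the undoubled difference over
    [2 ^ size ks] nearby points. *)
Lemma fdiffs_double_ge ks g x (t c : R) : 0 <= t -> bounded_by t ks ->
  (forall y, `|y| <= (size ks)%:R * t -> c <= fdiffs ks g (x + y)) ->
  2 ^+ size ks * c <= fdiffs [seq 2 *: k | k <- ks] g x.
Proof.
move=> t0; elim: ks g x c => [|k ks IH] g x c /=.
  by move=> _ /(_ 0); rewrite addr0 normr0 mul0r lexx mul1r; apply.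
case/andP => kt wks gc.
rewrite -fdiffs_fdiff exprSr -mulrA; apply: IH => // y yB.
have -> : fdiff (2 *: k) g = fun x => fdiff k g x + fdiff k g (x + k).
  by apply/funext => z; rewrite fdiff_double.
rewrite fdiffsD fdiffs_shift fdiffs_fdiff -(addrA x) mulr2n mulrDl !mul1r.
have yt : `|y| <= (size ks).+1%:R * t.
  by rewrite -natr1 mulrDl mul1r (le_trans yB)// lerDl.
rewrite lerD ?gc// -natr1 mulrDl mul1r (le_trans (ler_normD _ _))//.
by rewrite lerD.
Qed.

Lemma fdiffs_double_le ks g x (B t : R) : bounded_by t ks ->
  (forall y, `|fdiffs ks g y| <= B) ->
  `|fdiffs [seq 2 *: k | k <- ks] g x| <= 2 ^+ size ks * B.
Proof.
move=> wks gB.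
have wks' : bounded_by `|t| ks by apply: bounded_by_le wks; exact: ler_norm.
rewrite ler_norml; apply/andP; split.
  rewrite -mulrN; apply: (@fdiffs_double_ge _ _ _ `|t|) => // y _.
  by have := gB (x + y); rewrite ler_norml => /andP[].
rewrite -lerN2 -mulrN.
have -> : - fdiffs [seq 2 *: k | k <- ks] g x =
          fdiffs [seq 2 *: k | k <- ks] (fun x => - g x) x by rewrite fdiffsN.
apply: (@fdiffs_double_ge _ _ _ `|t|) => // y _.
by rewrite fdiffsN lerN2; have := gB (x + y); rewrite ler_norml => /andP[].
Qed.

(** Doubling an increment multiplies a difference by 2 up to a difference of
    higher order: [fdiff (2 k) = 2 fdiff k + fdiff k \o fdiff k]. *)
Lemma fdiffs_double_approx ks g x (t B : R) : 0 <= t -> bounded_by t ks ->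
  fdiffs_bounded (size ks).+1 t B g ->
  `|2 ^+ size ks * fdiffs ks g x - fdiffs [seq 2 *: k | k <- ks] g x|
    <= 3 ^+ size ks * B.
Proof.
move=> t0; elim: ks g x => [|k ks IH] g x /=.
  move=> _ gB; rewrite !expr0 !mul1r subrr normr0.
  exact: fdiffs_bounded_ge0 gB.
case/andP => kt wks gB; have B0 := fdiffs_bounded_ge0 t0 gB.
have Eg : fdiff (2 *: k) g =
    fun x => 2 * fdiff k g x + fdiff k (fdiff k g) x.
  apply/funext => z; rewrite fdiff_double.
  rewrite -[fdiff k (fdiff k g) z]/(fdiff k g (z + k) - fdiff k g z).
  set a := fdiff k g (z + k); set b := fdiff k g z; ring.
rewrite -!fdiffs_fdiff Eg (fdiffsD [seq 2 *: l | l <- ks]) fdiffsZ.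
set a := fdiffs ks _ x; set b := fdiffs _ (fdiff k g) x; set c := fdiffs _ _ x.
have ab : `|2 ^+ size ks * a - b| <= 3 ^+ size ks * B.
  by apply: IH => //; apply: fdiffs_bounded_fdiff.
have cB : `|c| <= 2 ^+ size ks * B.
  apply: (@fdiffs_double_le _ _ _ _ t) => // y.
  exact: (fdiffs_bounded_fdiff (fdiffs_bounded_fdiff gB kt) kt).
have -> : 2 ^+ (size ks).+1 * a - (2 * b + c) =
  2 * (2 ^+ size ks * a - b) - c by rewrite exprS; ring.
rewrite (le_trans (ler_normB _ _))// normrM ger0_norm//.
have le23 : 2 ^+ size ks * B <= 3 ^+ size ks * B.
  by rewrite ler_wpM2r// lerXn2r// ?nnegrE// ler_nat.
by rewrite exprS -mulrA; lra.
Qed.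

End finite_differences.

(** * Marchaud inequalities *)

Lemma gt1_ltr_powR {R : realType} (a x y : R) : 1 < a -> x < y -> a `^ x < a `^ y.
Proof.
move=> a1 xy; have a0 : 0 < a by rewrite (lt_trans _ a1).
rewrite -[y](subrK x) powRD ?(gt_eqF a0) ?implybT// ltr_pMl ?powR_gt0//.
rewrite lt_neqAle eq_sym powR_eq1 !negb_or (gt_eqF a1) -leNgt (ltW a0)/=.
by rewrite gt_eqF ?subr_gt0//= -[leLHS](powRr0 a) ler_powR ?ltW ?subr_gt0.
Qed.

Section marchaud.
Context {R : realType} {V : normedModType R}.
Implicit Types (g u : V -> R) (k x y : V) (ks : seq V).

Lemma fdiffs_bounded_mono n t t' B B' g : t' <= t -> B <= B' ->
  fdiffs_bounded n t B g -> fdiffs_bounded n t' B' g.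
Proof.
move=> tt' BB' gB ks x sks wks; apply: le_trans BB'; apply: gB => //.
exact: bounded_by_le wks.
Qed.

(** Induction over dyadic scales on the relation between a difference, its
    doubled version and differences of one order more: [phi] is any
    supersolution of the resulting recursive inequality. *)
Lemma marchaud_step i (r : R) (b phi : R -> R) g :
  (forall t : R, 0 < t <= r -> fdiffs_bounded i.+1 t (b t) g) ->
  (forall t : R, 0 < t -> r / 2 <= t <= r -> fdiffs_bounded i t (phi t) g) ->
  (forall t : R, 0 < t <= r / 2 -> (phi (2 * t) + 3 ^+ i * b t) / 2 ^+ i <= phi t) ->
  forall t : R, 0 < t <= r -> fdiffs_bounded i t (phi t) g.
Proof.
move=> gb gphi phiP.
suff H j t : 0 < t <= r -> r <= 2 ^+ j * t -> fdiffs_bounded i t (phi t) g.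
  move=> t /andP[t0 tr]; apply: (H (Num.bound (r / t))); first by rewrite t0.
  rewrite -ler_pdivrMr//; apply: le_trans (ltW (archi_boundP _)) _.
    by rewrite divr_ge0// ltW// (lt_le_trans t0).
  by rewrite -natrX ler_nat ltnW// ltn_expl.
elim: j t => [|j IH] t /andP[t0 tr].
  rewrite expr0 mul1r => rt; apply: gphi => //; rewrite tr andbT.
  by apply: le_trans rt; lra.
rewrite exprSr -mulrA => rt.
have [rt2|t2] := leP (r / 2) t; first by apply: gphi => //; rewrite rt2.
have g2 : fdiffs_bounded i (2 * t) (phi (2 * t)) g by apply: IH => //; lra.
have gbt : fdiffs_bounded i.+1 t (b t) g by apply: gb; rewrite t0.
move=> ks x sks wks; apply: le_trans (phiP t _); last by rewrite t0 ltW.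
rewrite ler_pdivlMr ?exprn_gt0// mulrC.
have : `|fdiffs [seq 2 *: k | k <- ks] g x| <= phi (2 * t).
  by apply: g2; rewrite ?size_map//; exact: bounded_by_double.
have := @fdiffs_double_approx _ _ ks g x t (b t) (ltW t0) wks.
rewrite sks => /(_ gbt).
rewrite -[X in X * `|_|]ger0_norm ?exprn_ge0// -normrM.
set p := _ * fdiffs _ _ _; set q := fdiffs _ _ _ => pq qphi.
have -> : p = q + (p - q) by ring.
by rewrite (le_trans (ler_normD _ _))// lerD.
Qed.

Lemma marchaud1 i (s : R) : 0 <= s < i%:R -> exists2 C : R, 1 <= C &
  forall g (B M r : R), 0 <= B -> 0 <= M -> 0 < r -> (forall x, `|g x| <= M) ->
  (forall t : R, 0 < t <= r -> fdiffs_bounded i.+1 t (B * t `^ s) g) ->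
  forall t : R, 0 < t <= r ->
    fdiffs_bounded i t (C * (B + M * r `^ (- s)) * t `^ s) g.
Proof.
move=> /andP[s0 si].
set a : R := 2 `^ s; set e : R := 2 ^+ i.
have a0 : 0 < a by rewrite powR_gt0.
have a1 : 1 <= a.
  by rewrite -(powRr0 2) ler_powR// ler1n.
have ae : a < e.
  by rewrite /e -powR_mulrn// gt1_ltr_powR// ltr1n.
have e1 : 1 <= e by rewrite exprn_ege1// ler1n.
set th : R := 3 ^+ i; have th0 : 0 < th by rewrite exprn_gt0.
have [D D0 De] : exists2 D : R, 0 <= D & D * e - D * a = th.
  exists (th / (e - a)); first by rewrite divr_ge0 ?subr_ge0 1?ltW.
  by rewrite -mulrBr divfK// gt_eqF// subr_gt0.
exists (e * a + D).
  by rewrite -[1](addr0) lerD// -[1](mulr1) ler_pM// (le_trans _ e1).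
move=> g B M r B0 M0 r0 gM gB.
set K := B + M * r `^ (- s).
have K0 : 0 <= K by rewrite addr_ge0// mulr_ge0// powR_ge0.
have BK : B <= K by rewrite lerDl mulr_ge0// powR_ge0.
apply: (@marchaud_step _ r (fun t => B * t `^ s)) => //.
- move=> t t0 /andP[rt tr]; apply: fdiffs_bounded_mono (fdiffs_bounded_sup gM) => //.
  have MK : M <= a * (K * t `^ s).
    have -> : M = M * r `^ (- s) * (r `^ s).
      by rewrite -mulrA -powRD ?addNr ?powRr0 ?mulr1// (gt_eqF r0) implybT.
    rewrite mulrCA ler_pM ?mulr_ge0 ?powR_ge0//; first by rewrite lerDr.
    rewrite -powRM ?(ltW t0)//.
    by apply: ge0_ler_powR; rewrite ?nnegrE//; lra.
  rewrite mulrDl mulrDl.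
  have : 0 <= D * K * t `^ s by rewrite !mulr_ge0// ?powR_ge0.
  suff : e * M <= e * a * K * t `^ s by rewrite -/e; lra.
  by rewrite -!mulrA ler_pM2l// (lt_le_trans ltr01 e1).
- move=> t /andP[t0 tr].
  rewrite powRM ?(ltW t0)// -/a -/e -/th ler_pdivrMr ?(lt_le_trans ltr01 e1)//.
  have T0 : 0 <= t `^ s by apply: powR_ge0.
  set T := t `^ s in T0 *.
  have : (th * B) * T <= (th * K) * T by rewrite ler_wpM2r// ler_wpM2l// ltW.
  have : 0 <= e * a * K * T * (e - a).
    by rewrite !mulr_ge0// ?subr_ge0 ltW// (lt_le_trans _ e1).
  have : (D * e - D * a) * (K * T) = th * (K * T) by rewrite De.
  lra.
Qed.

(** Marchaud's inequality.  Each halving of the scale gains the factor [2 ^- i]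
    of the doubling relation, which beats the loss [2 `^ s] since [s < i]; the
    recursion starts at scale [r], from the bound [M]. *)
Lemma marchaud n i (s : R) : 0 <= s < i%:R -> exists2 C : R, 1 <= C &
  forall g (B M r : R), 0 <= B -> 0 <= M -> 0 < r -> (forall x, `|g x| <= M) ->
  (forall t : R, 0 < t <= r -> fdiffs_bounded (n + i) t (B * t `^ s) g) ->
  forall t : R, 0 < t <= r ->
    fdiffs_bounded i t (C * (B + M * r `^ (- s)) * t `^ s) g.
Proof.
elim: n i => [|n IH] i si.
  exists 1 => // g B M r B0 M0 r0 gM gB t tr.
  apply: fdiffs_bounded_mono (gB t tr) => //.
  by rewrite mul1r ler_wpM2r ?powR_ge0// lerDl mulr_ge0// powR_ge0.
have [C1 C11 H1] := marchaud1 si.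
have [|C2 C21 H2] := IH i.+1.
  by move: si => /andP[-> si] /=; rewrite (lt_trans si)// ltr_nat.
exists (C1 * (C2 + 1)).
  by rewrite -[1](mulr1) ler_pM// -[X in X <= _]addr0 lerD// (le_trans _ C21).
move=> g B M r B0 M0 r0 gM gB t tr.
have C20 : 0 <= C2 by rewrite (le_trans _ C21).
have K0 : 0 <= M * r `^ (- s) by rewrite mulr_ge0// powR_ge0.
have {}H2 : forall t : R, 0 < t <= r ->
    fdiffs_bounded i.+1 t (C2 * (B + M * r `^ (- s)) * t `^ s) g.
  by apply: H2 => //; move=> t' tr'; rewrite addnS; exact: gB.
apply: fdiffs_bounded_mono (H1 g _ M r _ M0 r0 gM H2 t tr) => //.
  rewrite ler_wpM2r ?powR_ge0// -mulrA ler_wpM2l ?(le_trans _ C11)//.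
  by rewrite mulrDl lerD2l mul1r lerDr.
by rewrite mulr_ge0// addr_ge0.
Qed.

(** At the critical exponent [m] doubling gains nothing, but the geometric
    series of the errors still converges, because the differences of order
    [m + 1] decay at the faster rate [gam > m]. *)
Lemma marchaud_critical m (gam : R) : m%:R < gam -> exists2 C : R, 0 <= C &
  forall g (Z r : R), 0 <= Z -> 0 < r ->
  (forall t : R, 0 < t <= r -> fdiffs_bounded m.+1 t (Z * t `^ gam) g) ->
  fdiffs_bounded m r (Z * r `^ gam) g ->
  forall t : R, 0 < t <= r ->
    fdiffs_bounded m t (C * Z * r `^ (gam - m%:R) * t ^+ m) g.
Proof.
move=> mg.
set a : R := 2 `^ (gam - m%:R); set e : R := 2 ^+ m; set th : R := 3 ^+ m.
have a1 : 1 < a by rewrite -(powRr0 2) gt1_ltr_powR ?subr_gt0 ?ltr1n.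
have e1 : 1 <= e by rewrite exprn_ege1// ler1n.
have th0 : 0 < th by rewrite exprn_gt0.
have e0 : 0 < e by rewrite exprn_gt0.
have [D D0 De] : exists2 D : R, 0 <= D & D * a - D = th / e.
  exists (th / e / (a - 1)); first by rewrite !divr_ge0 ?subr_ge0 1?ltW.
  by rewrite -[X in _ - X]mulr1 -mulrBr divfK// gt_eqF// subr_gt0.
exists (e + D); first by rewrite addr_ge0// ltW.
move=> g Z r Z0 r0 gZ gr t tr.
pose phi t := Z * ((e + D) * r `^ (gam - m%:R) - D * t `^ (gam - m%:R)) * t ^+ m.
have powE (y : R) : 0 < y -> y `^ gam = y `^ (gam - m%:R) * y ^+ m.
  by move=> y0; rewrite -powR_mulrn ?ltW// -powRD ?subrK// (gt_eqF y0) implybT.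
apply: (@fdiffs_bounded_mono _ t _ (phi t)) => //.
  have t0 : 0 <= t by case/andP: tr => /ltW.
  rewrite /phi ler_wpM2r ?exprn_ge0// (mulrC (e + D) Z) -mulrA ler_wpM2l//.
  by rewrite lerBlDr lerDl mulr_ge0// powR_ge0.
move: t tr; apply: (@marchaud_step _ r (fun t => Z * t `^ gam)) => //.
- move=> t t0 /andP[rt tr]; apply: fdiffs_bounded_mono gr => //.
  rewrite /phi -mulrA ler_wpM2l// powE//.
  have h1 : t `^ (gam - m%:R) <= r `^ (gam - m%:R).
    by rewrite ge0_ler_powR// ?nnegrE ?subr_ge0 ltW.
  have h2 : r ^+ m <= e * t ^+ m.
    by rewrite -exprMn lerXn2r// ?nnegrE; lra.
  have h3 : e * r `^ (gam - m%:R) <= (e + D) * r `^ (gam - m%:R) - D * t `^ (gam - m%:R).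
    by rewrite mulrDl -addrA lerDl subr_ge0 ler_wpM2l.
  apply: le_trans (ler_wpM2r _ h3); last by rewrite exprn_ge0// ltW.
  by rewrite (mulrC e) -mulrA ler_wpM2l// powR_ge0.
- move=> t /andP[t0 tr].
  rewrite /phi powRM ?(ltW t0)// -/a exprMn -/e -/th powE//.
  set P := t `^ _; set T := t ^+ m; set Q := r `^ _.
  have -> : (Z * ((e + D) * Q - D * (a * P)) * (e * T) + th * (Z * (P * T))) / e
    = Z * ((e + D) * Q - (D * a - th / e) * P) * T.
    by field; rewrite gt_eqF.
  have -> : D * a - th / e = D by rewrite -De; ring.
  by [].
Qed.

End marchaud.

(** * Differences of differentiable functions *)

Section smooth_differences.
Context {R : realType} {d : nat}.
Local Notation V := 'rV[R]_d.
Implicit Types (g u : V -> R) (k x y h : V) (ks : seq V) (j : seq 'I_d).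

Lemma derive_grad_dot g x h : differentiable g x -> 'D_h g x = grad_dot g x h.
Proof.
move=> dg; rewrite deriveE// {1}(row_sum_delta h) linear_sum /grad_dot.
apply: eq_bigr => i _; rewrite linearZ /partial deriveE//=.
by rewrite mulrC.
Qed.

Lemma is_derive_line g x k (t : R) : differentiable g (x + t *: k) ->
  is_derive t 1 (fun s : R => g (x + s *: k)) (grad_dot g (x + t *: k) k).
Proof.
move=> dg; have dv := @diff_derivable _ _ _ _ _ k dg.
have E : (fun h : R => h^-1 *: (((fun s : R => g (x + s *: k)) \o shift t) (h *: 1)
    - g (x + t *: k))) =
    (fun h : R => h^-1 *: ((g \o shift (x + t *: k)) (h *: k) - g (x + t *: k))).
  apply/funext => h /=; congr (_ *: (g _ - _)).
  by rewrite scalerDl addrCA -scalerA scale1r.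
split; first by rewrite /derivable E; exact: dv.
by rewrite -derive_grad_dot// /derive E.
Qed.

Lemma mvt_grad g x k : (forall y, differentiable g y) ->
  exists2 c : R, 0 <= c <= 1 & g (x + k) - g x = grad_dot g (x + c *: k) k.
Proof.
move=> dg.
have der (t : R) := is_derive_line (dg (x + t *: k)).
have [|c c01] := @MVT_segment R (fun s : R => g (x + s *: k))
    (fun s => grad_dot g (x + s *: k) k) 0 1 ler01 (fun t _ => der t).
  apply: derivable_within_continuous => t _.
  by have [] := der t.
rewrite scale1r scale0r addr0 subr0 mulr1 => E.
by exists c => //; move: c01; rewrite in_itv.
Qed.

Lemma differentiable_fdiff g k : (forall y, differentiable g y) ->
  forall x, differentiable (fdiff k g) x.
Proof.
move=> dg x; apply: differentiableB => //.
apply: (@differentiable_comp _ _ _ _ (fun y => y + k) g) => //.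
Qed.

Lemma partial_fdiff g k i : (forall y, differentiable g y) ->
  partial i (fdiff k g) = fdiff k (partial i g).
Proof.
move=> dg; apply/funext => x; rewrite /partial.
have dgk : differentiable (fun y => g (y + k)) x.
  apply: (@differentiable_comp _ _ _ _ (fun y => y + k) g) => //.
rewrite (_ : fdiff k g = (fun y => g (y + k)) - g)//.
rewrite deriveB; [|exact: diff_derivable..].
rewrite /fdiff; congr (_ - _); rewrite /derive.
rewrite (_ : (fun h : R => _) = fun h : R =>
    h^-1 *: ((g \o shift (x + k)) (h *: delta_mx ord0 i) - g (x + k)))//.
by apply/funext => h /=; rewrite addrA.
Qed.

Lemma times_differentiable_pred m g :
  times_differentiable m.+1 g -> times_differentiable m g.
Proof.
elim: m g => [//|m IH] g [dg dpg]; split=> // i.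
exact: IH (dpg i).
Qed.

Lemma times_differentiable_fdiff m g k :
  times_differentiable m g -> times_differentiable m (fdiff k g).
Proof.
elim: m g => [//|m IH] g [dg dpg]; split=> [x|i].
  exact: differentiable_fdiff.
by rewrite partial_fdiff//; apply: IH; exact: dpg.
Qed.

Lemma partial_fdiffs g ks i : (forall y, differentiable g y) ->
  partial i (fdiffs ks g) = fdiffs ks (partial i g).
Proof.
move=> dg; elim: ks => //= k ks <-; apply: partial_fdiff.
by elim: ks => //= l ks; exact: differentiable_fdiff.
Qed.

Lemma iter_partial_rcons j i g :
  iter_partial (rcons j i) g = iter_partial j (partial i g).
Proof. exact: foldr_rcons. Qed.

Lemma times_differentiable_iter j m g :
  times_differentiable (size j + m) g -> times_differentiable m (iter_partial j g).
Proof.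
elim/last_ind: j g => //= j i IH g; rewrite size_rcons iter_partial_rcons.
by case=> _ /(_ i) /IH.
Qed.

Lemma iter_partial_fdiff j g k : times_differentiable (size j) g ->
  iter_partial j (fdiff k g) = fdiff k (iter_partial j g).
Proof.
elim/last_ind: j g => //= j i IH g; rewrite size_rcons !iter_partial_rcons.
by case=> dg /(_ i) /IH <-; rewrite partial_fdiff.
Qed.


Lemma rV_norm_le x (c : R) : 0 <= c -> (forall i, `|x ord0 i| <= c) -> `|x| <= c.
Proof.
move=> c0 xc; rewrite [`|x|]mx_normrE; apply: bigmax_le => // -[i i'] _ /=.
by rewrite ord1.
Qed.

Lemma rV_coord_le x i : `|x ord0 i| <= `|x|.
Proof.
rewrite [`|x|]mx_normrE.
exact: (le_bigmax _ (fun ij : 'I_1 * 'I_d => `|x ij.1 ij.2|) (ord0, i)).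
Qed.

Lemma enorm_ge x : `|x| <= enorm x.
Proof.
apply: rV_norm_le; first exact: sqrtr_ge0.
move=> i; rewrite -sqrtr_sqr ler_wsqrtr// (bigD1 i)//= lerDl.
by apply: sumr_ge0 => k _; exact: sqr_ge0.
Qed.

Lemma enorm_le x : enorm x <= d%:R * `|x|.
Proof.
have h0 : 0 <= d%:R * `|x| by rewrite mulr_ge0.
rewrite /enorm -(ger0_norm h0) -sqrtr_sqr ler_wsqrtr//.
apply: (@le_trans _ _ (\sum_(i < d) `|x| ^+ 2)).
  apply: ler_sum => i _; rewrite -[leLHS]real_normK ?num_real//.
  by rewrite lerXn2r ?nnegrE// rV_coord_le.
rewrite sumr_const card_ord exprMn -[leLHS]mulr_natl ler_wpM2r ?sqr_ge0//.
by rewrite -natrX ler_nat; case: (d) => // n; rewrite expnS expn1 leq_pmulr.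
Qed.

Lemma enorm_gt0 x : x != 0 -> 0 < enorm x.
Proof. by move=> x0; rewrite (lt_le_trans _ (enorm_ge x))// normr_gt0. Qed.

Lemma normr_delta i (t : R) : 0 <= t -> `|t *: delta_mx ord0 i : V| <= t.
Proof.
move=> t0; apply: rV_norm_le => // k; rewrite !mxE eqxx /=.
by case: (k == i); rewrite ?mulr1 ?mulr0 ?normr0// ger0_norm.
Qed.

End smooth_differences.

Section differences_and_derivatives.
Context {R : realType} {d : nat}.
Local Notation V := 'rV[R]_d.
Implicit Types (g u : V -> R) (k x y h : V) (ks : seq V) (j : seq 'I_d).

(** One mean value theorem per increment, the derivatives commuting with the
    remaining differences. *)
Lemma iter_mvt j g x (t : R) : 0 <= t -> times_differentiable (size j) g ->
  exists2 xi, `|xi - x| <= (size j)%:R * t &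
    fdiffs [seq t *: delta_mx ord0 i | i <- j] g x =
    t ^+ size j * iter_partial j g xi.
Proof.
move=> t0; elim: j g x => [|i j IH] g x /= dg.
  by exists x; rewrite ?subrr ?normr0 ?mul0r// mul1r.
rewrite -fdiffs_fdiff.
set k := t *: delta_mx ord0 i; have kt : `|k| <= t by exact: normr_delta.
have dg' : times_differentiable (size j) g by exact: times_differentiable_pred.
have [xi xix ->] := IH (fdiff k g) x (times_differentiable_fdiff k dg').
rewrite iter_partial_fdiff//.
have dj : forall y, differentiable (iter_partial j g) y.
  by have [] : times_differentiable 1 (iter_partial j g)
    by apply: times_differentiable_iter; rewrite addn1.
have [c /andP[c0 c1] ck] := mvt_grad xi k dj.
exists (xi + c *: k).
  rewrite addrAC (le_trans (ler_normD _ _))// -natr1 mulrDl mul1r lerD//.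
  by rewrite normrZ ger0_norm// (le_trans _ kt)// ler_piMl.
rewrite /fdiff ck /grad_dot (bigD1 i)//= big1 => [|i' i'i].
  by rewrite addr0 /k !mxE !eqxx mulr1 exprSr -mulrA (mulrC t).
by rewrite /k !mxE eqxx (negbTE i'i) !mulr0.
Qed.

Lemma grad_dot_le g x h (B : R) : 0 <= B ->
  (forall i, `|partial i g x| <= B) -> `|grad_dot g x h| <= d%:R * B * `|h|.
Proof.
move=> B0 gB; rewrite /grad_dot (le_trans (ler_norm_sum _ _ _))//.
apply: (@le_trans _ _ (\sum_(i < d) B * `|h|)); last first.
  by rewrite sumr_const card_ord -mulrA mulr_natl.
by apply: ler_sum => i _; rewrite normrM ler_pM// rV_coord_le.
Qed.

(** This makes the best constant in the bound on differences finite, which is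
    what allows small multiples of it to be absorbed. *)
Lemma holder_fdiffs m g (H theta t : R) : 0 <= H -> 0 <= theta -> 0 <= t ->
  times_differentiable m g ->
  (forall j, size j = m -> forall x h,
     `|iter_partial j g (x + h) - iter_partial j g x| <= H * `|h| `^ theta) ->
  fdiffs_bounded m.+1 t (d%:R ^+ m * H * t ^+ m * t `^ theta) g.
Proof.
move=> H0 th0 t0; elim: m g => [|m IH] g.
  move=> _ /(_ [::] erefl) gH [|k [|//]] x //= _ /andP[kt _].
  rewrite !expr0 mulr1 mul1r (le_trans (gH x k))// ler_wpM2l//.
  by apply: ge0_ler_powR; rewrite ?nnegrE.
move=> [dg dpg] gH [|k ks] x //= [sks] /andP[kt wks].
have dfg : forall y, differentiable (fdiffs ks g) y.
  by elim: (ks) => //= l ls; exact: differentiable_fdiff.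
have [c _ ck] := mvt_grad x k dfg.
rewrite {1}/fdiff ck.
apply: le_trans (grad_dot_le _ (B := d%:R ^+ m * H * t ^+ m * t `^ theta) _ _) _.
- by rewrite !mulr_ge0 ?powR_ge0// exprn_ge0.
- move=> i; rewrite partial_fdiffs//; apply: IH => //; first exact: dpg.
  move=> j sj y h.
  by rewrite -iter_partial_rcons; apply: gH; rewrite size_rcons sj.
set P := t `^ theta.
have P0 : 0 <= P by exact: powR_ge0.
rewrite !exprS.
have -> : d%:R * d%:R ^+ m * H * (t * t ^+ m) * P =
   d%:R * (d%:R ^+ m * H * t ^+ m * P) * t by ring.
by rewrite ler_wpM2l// !mulr_ge0// exprn_ge0.
Qed.

Lemma powR_small (H theta e : R) : 0 < theta -> 0 <= H -> 0 < e ->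
  exists2 t : R, 0 < t & forall s : R, 0 <= s <= t -> H * s `^ theta <= e.
Proof.
move=> th0 H0 e0.
have q0 : 0 < e / (H + 1) by rewrite divr_gt0// ltr_wpDl.
exists ((e / (H + 1)) `^ (theta^-1)); first exact: powR_gt0.
move=> s /andP[s0 sle].
apply: (@le_trans _ _ ((H + 1) * (e / (H + 1)))); last first.
  by rewrite mulrC divfK// gt_eqF// ltr_wpDl.
apply: ler_pM; rewrite ?powR_ge0// ?lerDl//.
have -> : e / (H + 1) = ((e / (H + 1)) `^ theta^-1) `^ theta.
  by rewrite -powRrM mulVf ?gt_eqF// powRr1// ltW.
by apply: ge0_ler_powR; rewrite ?nnegrE ?powR_ge0 ?(ltW th0)//.
Qed.

(** Dividing the differences by [t ^ m] gives the derivative at a point [xi]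
    that tends to [x] with [t]; continuity of the derivative passes to the
    limit without any trace of [H] in the bound. *)
Lemma iter_partial_le j g x (H theta K r : R) :
  0 <= H -> 0 < theta -> 0 < r -> times_differentiable (size j) g ->
  (forall y h, `|iter_partial j g (y + h) - iter_partial j g y| <= H * `|h| `^ theta) ->
  (forall t : R, 0 < t <= r -> fdiffs_bounded (size j) t (K * t ^+ size j) g) ->
  `|iter_partial j g x| <= K.
Proof.
move=> H0 th0 r0 dg gH gK; apply/ler_addgt0Pr => e e0.
have [s s0 sP] := powR_small th0 H0 e0.
set t := Num.min r (s / (size j).+1%:R).
have t0 : 0 < t by rewrite lt_min r0 divr_gt0.
have [xi xix E] := iter_mvt x (ltW t0) dg.
have : `|t ^+ size j * iter_partial j g xi| <= K * t ^+ size j.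
  rewrite -E; apply: gK; rewrite ?size_map ?t0 ?ge_min ?lexx//.
  by apply/allP => _ /mapP[i _ ->]; rewrite normr_delta// ltW.
rewrite normrM normrX (ger0_norm (ltW t0)) mulrC ler_pM2r ?exprn_gt0// => xiK.
have := gH x (xi - x); rewrite subrKC => xiH.
have xis : `|xi - x| <= s.
  rewrite (le_trans xix)// (@le_trans _ _ ((size j).+1%:R * t))//.
    by rewrite ler_wpM2r ?ler_nat// ltW.
  by rewrite mulrC -ler_pdivlMr// ge_min lexx orbT.
have {}xiH := le_trans xiH (sP _ (introT andP (conj (normr_ge0 _) xis))).
rewrite -[iter_partial j g x](subKr (iter_partial j g xi)).
by rewrite (le_trans (ler_normB _ _))// lerD.
Qed.

Lemma derive_dyadic g y h (e : R) : derivable g y h -> 0 < e ->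
  exists n : nat, `|2 ^+ n * (g (y + (2 ^- n) *: h) - g y) - 'D_h g y| <= e.
Proof.
move=> /cvgrPdist_lt /(_ e) dg e0; have := dg e0.
rewrite near_withinE => -[r /= r0 rP].
have [n nr] : exists n : nat, 2 ^- n < r.
  exists (Num.bound r^-1); rewrite invf_plt ?posrE ?exprn_gt0//.
  rewrite (lt_trans (archi_boundP _)) ?invr_ge0 ?(ltW r0)//.
  by rewrite -natrX ltr_nat ltn_expl.
exists n; rewrite distrC.
have /(_ _ _) := rP (2 ^- n).
rewrite /= sub0r normrN ger0_norm ?invr_ge0 ?exprn_ge0// => /(_ nr).
rewrite invr_neq0 ?expf_neq0// invrK (addrC _ y) => /(_ isT) /ltW.
by apply.
Qed.

(** The dyadic difference quotients of [u] in the direction [h] start at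
    [u (y + h) - u y] and tend to the derivative; consecutive ones differ by a
    second difference, which decays geometrically because [kappa > 1]. *)
Lemma taylor_fdiff2 (kappa : R) : 1 < kappa -> exists2 C : R, 0 <= C &
  forall u (E r : R) y h, 0 <= E -> `|h| <= r -> differentiable u y ->
  (forall t : R, 0 < t <= r -> fdiffs_bounded 2 t (E * t `^ kappa) u) ->
  `|u (y + h) - u y - grad_dot u y h| <= C * E * `|h| `^ kappa.
Proof.
move=> k1; set c : R := 2^-1 `^ kappa.
have c0 : 0 < c by apply: powR_gt0; rewrite invr_gt0.
have c12 : 2 * c < 1.
  rewrite mulrC -ltr_pdivlMr// div1r /c -(@powR_inv1 R 2)// -powRrM mulN1r.
  by rewrite gt1_ltr_powR ?ltr1n// ltrN2.
have C0 : 0 <= c / (1 - 2 * c) by apply: divr_ge0; rewrite ?subr_ge0 ltW.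
exists (c / (1 - 2 * c)) => //.
move=> u E r y h E0 hr du uE.
have [->|h0] := eqVneq h 0.
  rewrite addr0 subrr sub0r /grad_dot big1 ?oppr0 ?normr0.
    by rewrite mulr_ge0 ?powR_ge0// mulr_ge0.
  by move=> i _; rewrite mxE mulr0.
have r0 : 0 < r by rewrite (lt_le_trans _ hr)// normr_gt0.
pose a n := 2 ^+ n * (u (y + (2 ^- n) *: h) - u y).
set P := E * `|h| `^ kappa.
have P0 : 0 <= P by rewrite mulr_ge0 ?powR_ge0.
have da n : `|a n.+1 - a n| <= c * P * (2 * c) ^+ n.
  set l := 2 ^- n.+1 *: h.
  have l2 : 2 ^- n *: h = l + l.
    rewrite /l -scalerDl; congr (_ *: _).
    by rewrite exprS; field; rewrite expf_neq0.
  have -> : a n.+1 - a n = - (2 ^+ n * fdiffs [:: l; l] u y).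
    by rewrite /a -/l l2 /= /fdiff exprS (addrA y); ring.
  have nl : `|l| = 2 ^- n.+1 * `|h|.
    by rewrite /l normrZ ger0_norm// invr_ge0 exprn_ge0.
  have l0 : 0 < `|l| by rewrite nl mulr_gt0 ?invr_gt0 ?exprn_gt0 ?normr_gt0.
  have lr : `|l| <= r.
    by rewrite nl (le_trans _ hr)// ler_piMl// invf_le1 ?exprn_gt0// exprn_ege1// ler1n.
  rewrite normrN normrM ger0_norm ?exprn_ge0//.
  have -> : c * P * (2 * c) ^+ n = 2 ^+ n * (E * `|l| `^ kappa).
    rewrite nl powRM// ?invr_ge0 ?exprn_ge0// -exprVn -(@powR_mulrn _ 2^-1) ?invr_ge0//.
    by rewrite powRAC powR_mulrn ?powR_ge0// -/c exprS exprMn /P; ring.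
  rewrite ler_wpM2l ?exprn_ge0//.
  by apply: (uE `|l|) => //=; rewrite ?l0 ?lr// lexx.
have an n : `|a n - a 0%N| <= c * P * (1 - (2 * c) ^+ n) / (1 - 2 * c).
  elim: n => [|n IH]; first by rewrite subrr normr0 expr0 subrr mulr0 mul0r.
  have -> : a n.+1 - a 0%N = (a n.+1 - a n) + (a n - a 0%N) by ring.
  rewrite (le_trans (ler_normD _ _))// (le_trans (lerD (da n) IH))//.
  rewrite le_eqVlt; apply/orP; left; apply/eqP.
  by rewrite exprS; field; rewrite subr_eq0 gt_eqF.
have a0 : a 0%N = u (y + h) - u y.
  by rewrite /a expr0 mul1r invr1 scale1r.
rewrite -derive_grad_dot// -a0; apply/ler_addgt0Pr => e e0.
have [n nP] := derive_dyadic (diff_derivable (v := h) du) e0.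
have -> : a 0%N - 'D_h u y = (a n - 'D_h u y) - (a n - a 0%N) by ring.
rewrite (le_trans (ler_normB _ _))// addrC lerD// (le_trans (an n))//.
rewrite -[leRHS]mulrA -/P.
rewrite (mulrAC c P) -(mulrA _ P) (mulrC P) mulrA (mulrAC c) ler_wpM2r//.
by rewrite ler_piMr// gerBl exprn_ge0// mulr_ge0// ltW.
Qed.

End differences_and_derivatives.

(** * Lebesgue measure on row vectors *)

Section lebesgue_rV_facts.
Context {R : realType} {d : nat}.
Local Notation V := 'rV[R]_d.
Local Notation mu := (lebesgue_rV R d).
Implicit Types (g u : V -> R) (x y h : V).

Definition cube x (r : R) : set V := [set y | `|y - x| <= r].

Lemma cubeE x r : 0 <= r -> cube x r =
  [set y | forall i, `[x ord0 i - r, x ord0 i + r]%classic (y ord0 i)].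
Proof.
move=> r0; apply/seteqP; split => y /= yx.
  move=> i; have := le_trans (rV_coord_le (y - x) i) yx.
  by rewrite !mxE ler_distl in_itv.
apply: rV_norm_le => // i; rewrite !mxE ler_distl.
by have := yx i; rewrite in_itv.
Qed.

Lemma measurable_cube x r : 0 <= r -> measurable (cube x r).
Proof.
move=> r0; rewrite (_ : cube x r = \bigcap_(i : 'I_d)
    (fun y : V => y ord0 i : measurableTypeR R) @^-1`
       `[x ord0 i - r, x ord0 i + r]%classic); last first.
  rewrite cubeE//; apply/seteqP.
  by split => y /= h i; [move=> _; exact: h|exact: (h i Logic.I)].
apply: fin_bigcap_measurable => // i _.
by rewrite -[X in measurable X]setTI; exact: measurable_rV_coord.
Qed.

Lemma lebesgue_rV_cube x r : 0 <= r -> mu (cube x r) = ((2 * r) ^+ d)%:E.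
Proof.
move=> r0; rewrite cubeE//.
rewrite [LHS](@lebesgue_rV_box R d
  (fun i => `[x ord0 i - r, x ord0 i + r]%classic))//.
rewrite (eq_bigr (fun=> (2 * r)%:E)) => [|i _].
  rewrite prodEFin prodr_const card_ord//.
rewrite lebesgue_measure_itv/= lte_fin.
case: ltP => h.
  by rewrite -EFinB; congr (_%:E); ring.
by congr (_%:E); lra.
Qed.

(** The sigma-algebra generated by the coordinates contains the cubes, and an
    open set is the union of the countably many cubes with rational centre and
    radius [1 / n] that it contains. *)
Lemma open_measurable_rV (O : set V) : open O -> measurable O.
Proof.
move=> oO.
pose F (q : 'rV[rat]_d * nat) : set V :=
  let c := cube (map_mx ratr q.1) q.2.+1%:R^-1 in
  if `[< c `<=` O >] then c else set0.
have -> : O = \bigcup_q F q.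
  apply/seteqP; split => [x Ox|x [q _]]; last first.
    by rewrite /F; case: asboolP => // /(_ x) cO /cO.
  have /nbhs_ballP[e /= e0 eO] : nbhs x O by exact: open_nbhs_nbhs.
  have [n ne] : exists n : nat, n.+1%:R^-1 < e / 2.
    have e20 : 0 < e / 2 by rewrite divr_gt0.
    exists (Num.bound (e / 2)^-1); rewrite invf_plt ?posrE//.
    by rewrite (lt_le_trans (archi_boundP _)) ?invr_ge0 ?(ltW e20)// ler_nat.
  have qP i : exists q : rat, `|ratr q - x ord0 i| <= n.+1%:R^-1.
    have n0 : 0 < n.+1%:R^-1 :> R by rewrite invr_gt0.
    have [q] : exists q : rat, ratr q \in `]x ord0 i - n.+1%:R^-1, x ord0 i + n.+1%:R^-1[.
      by apply: rat_in_itvoo; rewrite ltrBlDr -addrA ltrDl addr_gt0.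
    by rewrite in_itv/= => /andP[q1 q2]; exists q; rewrite ler_distl !ltW.
  have [q qx] := choice qP.
  exists (\row_i q i, n) => //; rewrite /F /=.
  have xc : cube (map_mx ratr (\row_i q i)) n.+1%:R^-1 x.
    apply: rV_norm_le => // i; rewrite !mxE distrC; exact: qx.
  case: asboolP => // -[] y yc; apply: eO; rewrite -ball_normE /=.
  rewrite -(subrKA (map_mx ratr (\row_i q i))) (le_lt_trans (ler_normD _ _))//.
  rewrite [e]splitr ltrD// ?(le_lt_trans _ ne)//.
  by rewrite distrC.
apply: countable_bigcupT_measurable; first exact: countableP.
move=> q; rewrite /F; case: ifP => // _; exact: measurable_cube.
Qed.

Lemma continuous_measurable_rV u : continuous u -> measurable_fun [set: V] u.
Proof.
move=> /continuousP cu; apply: (measurability _ (RGenOpens.measurableE R)).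
move=> _ [_ [a [b ->] <-]]; rewrite setTI; apply: open_measurable_rV.
exact/cu/interval_open.
Qed.

Lemma measurable_norm_rV : measurable_fun [set: V] (fun h : V => `|h|).
Proof. by apply: continuous_measurable_rV => x; exact: norm_continuous. Qed.

Lemma measurable_enorm : measurable_fun [set: V] (@enorm R d).
Proof.
apply: measurableT_comp.
  by apply: continuous_measurable_fun; exact: sqrt_continuous.
apply: measurable_sum => i; apply: measurable_funX; exact: measurable_rV_coord.
Qed.

Lemma measurable_grad_dot u x : measurable_fun [set: V] (grad_dot u x).
Proof.
apply: measurable_sum => i; apply: measurable_funM => //.
exact: measurable_rV_coord.
Qed.

Lemma holder_continuous g (H theta : R) : 0 <= H -> 0 < theta ->
  (forall x h, `|g (x + h) - g x| <= H * `|h| `^ theta) -> continuous g.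
Proof.
move=> H0 th0 gH x; have FF : Filter (nbhs x) by exact: nbhs_filter.
  apply/(@cvgrPdist_le _ _ _ (nbhs x)) => e e0.
have [t t0 tP] := powR_small th0 H0 e0.
apply/nbhs_ballP; exists t => // y; rewrite -ball_normE /= => xy.
rewrite distrC -[y](subrKC x).
apply: le_trans (gH _ _) _; apply: tP; rewrite normr_ge0 /= distrC.
exact: ltW.
Qed.

Lemma measurable_neq0_rV : measurable [set h : V | h != 0].
Proof.
rewrite (_ : [set h | _] = (fun h : V => `|h|) @^-1` `]0, +oo[%classic).
  by rewrite -[X in measurable X]setTI; exact: measurable_norm_rV.
by apply/seteqP; split => h /=; rewrite in_itv/= andbT normr_gt0.
Qed.

(** Cubes have positive measure, so the essential supremum sees every value of
    a continuous function. *)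
Lemma continuous_le_Linfty u x : continuous u -> (`|u x|%:E <= Linfty_norm u)%E.
Proof.
move=> cu.
have muT : (0 < mu setT)%E.
  apply: (@lt_le_trans _ _ (mu (cube 0 1))).
    by rewrite lebesgue_rV_cube// lte_fin exprn_gt0// mulr1.
  by apply: le_measure; rewrite ?inE//; exact: measurable_cube.
rewrite /Linfty_norm unlock muT; rewrite leNgt; apply/negP => uL.
have [c cL cu'] : exists2 c : R, (ess_sup mu (abse \o (EFin \o u)) <= c%:E)%E & c < `|u x|.
  move: uL; case: (ess_sup _ _) => [c| |]//=.
    by rewrite lte_fin => cu'; exists c.
  by move=> _; exists (`|u x| - 1); rewrite ?leNye// ltrBlDr ltrDl.
have /ess_supP [N [mN N0 NP]] := cL.
have /nbhs_ballP[e /= e0 eu] : nbhs x [set y | c < `|u y|].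
  have FF : Filter (nbhs x) by exact: nbhs_filter.
  have cu1 : (`|u y|) @[y --> x] --> `|u x| by exact: cvg_norm (cu x).
  exact: (cvgr_gt _ cu1).
have : (mu (cube x (e / 2)) <= mu N)%E.
  have e20 : 0 <= e / 2 by rewrite divr_ge0// ltW.
  apply: le_measure; rewrite ?inE//; first exact: measurable_cube.
  move=> y xy; apply: NP => /=; rewrite lee_fin; apply/negP; rewrite -ltNge.
  apply: eu; rewrite -ball_normE /= distrC (le_lt_trans xy)//.
  by rewrite ltr_pdivrMr// ltr_pMr// ltr1n.
rewrite N0 lebesgue_rV_cube ?divr_ge0 ?(ltW e0)// lee_fin leNgt.
by rewrite exprn_gt0// mulr_gt0// divr_gt0.
Qed.

Lemma Linfty_norm_ge0 u : (0 <= Linfty_norm u)%E.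
Proof. exact: Lnorm_ge0. Qed.

End lebesgue_rV_facts.

(** * Integrability of the kernel *)

Section kernel.
Context {R : realType} {d : nat}.
Local Notation V := 'rV[R]_d.
Local Notation mu := (lebesgue_rV R d).
Implicit Types (g u : V -> R) (x y h : V).

(** Domination by the series of the [c j] times the indicators of the cubes,
    which is integrated termwise. *)
Lemma integral_cubes_le (c r : nat -> R) (rho K : R) (D : set V) (f : V -> R) :
  (forall j, 0 <= c j) -> (forall j, 0 <= r j) -> 0 < rho < 1 -> 0 <= K ->
  (forall j, c j * (2 * r j) ^+ d <= K * rho ^+ j) ->
  measurable D -> measurable_fun D f -> (forall h, D h -> 0 <= f h) ->
  (forall h, D h -> exists2 j, `|h| <= r j & f h <= c j) ->
  (\int[mu]_(h in D) (f h)%:E <= (K / (1 - rho))%:E)%E.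
Proof.
move=> c0 r0 /andP[rho0 rho1] K0 cK mD mf f0 fc.
pose F j h : \bar R := (c j * \1_(cube 0 (r j)) h)%:E.
have F0 j h : (0 <= F j h)%E by rewrite lee_fin mulr_ge0.
have mF j : measurable_fun D (F j).
  apply/measurable_EFinP; apply: measurable_funM => //.
  by apply: measurable_indic; exact: measurable_cube.
apply: (@le_trans _ _ (\int[mu]_(h in D) \sum_(0 <= j <oo) F j h)%E).
  apply: ge0_le_integral => //.
  - by apply/measurable_EFinP.
  - exact: ge0_emeasurable_sum.
  move=> h Dh; have [j hj fj] := fc h Dh.
  apply: (@le_trans _ _ (F j h)).
    by rewrite lee_fin indicE mem_set ?mulr1// /cube /= subr0.
  rewrite (nneseriesD1 (n := j))//=.
  by rewrite leeDl// nneseries_ge0.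
rewrite integral_nneseries//.
have IF j : (\int[mu]_(h in D) F j h <= (K * rho ^+ j)%:E)%E.
  rewrite /F; under eq_integral do rewrite EFinM.
  rewrite ge0_integralZl_EFin//; last first.
  - by apply/measurable_EFinP; apply: measurable_indic; exact: measurable_cube.
  rewrite (integral_indic _ mD (measurable_cube 0 (r0 j))).
  apply: (@le_trans _ _ (c j * (2 * r j) ^+ d)%:E); last by rewrite lee_fin.
  rewrite EFinM lee_wpmul2l ?lee_fin// -(lebesgue_rV_cube 0)//.
  have mC := measurable_cube (0 : V) (r0 j).
  by apply: le_measure; rewrite ?inE; [exact: measurableI| |exact: subIsetl].
apply: lime_le.
  by apply: is_cvg_nneseries => n _ _; exact: integral_ge0.
apply: nearW => n.
apply: (@le_trans _ _ (\sum_(0 <= j < n) (K * rho ^+ j)%:E)%E).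
  by apply: lee_sum => j _; exact: IF.
rewrite sumEFin lee_fin.
have -> : \sum_(0 <= j < n) K * rho ^+ j = series (geometric K rho) n by [].
by apply: geometric_le_lim => //; rewrite ger0_norm// ltW.
Qed.

Lemma dyadic_between (y : R) : 1 <= y -> exists j : nat, 2 ^+ j <= y < 2 ^+ j.+1.
Proof.
move=> y1.
have ex : exists n, y < 2 ^+ n.
  exists (Num.bound y); rewrite (lt_trans (archi_boundP _)) ?(le_trans _ y1)//.
  by rewrite -natrX ltr_nat ltn_expl.
case: (ex_minnP ex) => -[|j] yj jmin; first by move: yj; rewrite expr0 ltNge y1.
exists j; rewrite yj andbT leNgt; apply/negP => /jmin.
by rewrite ltnn.
Qed.

Lemma pow2D (x y : R) : 2 `^ (x + y) = 2 `^ x * 2 `^ y :> R.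
Proof. by rewrite powRD// pnatr_eq0 implybT. Qed.

Lemma measurable_kernel_weight (kappa e : R) : measurable_fun [set: V]
  (fun h : V => Num.min 1 (`|h| `^ kappa) / enorm h `^ e).
Proof.
apply: measurable_funM.
  apply: measurable_minr => //.
  by apply: (measurableT_comp (measurable_powR _)); exact: measurable_norm_rV.
rewrite (_ : (fun h => _) = fun h : V => enorm h `^ (- e)).
  by apply: (measurableT_comp (measurable_powR _)); exact: measurable_enorm.
by apply/funext => h; rewrite powRN.
Qed.

(** Dyadic annuli: the weight makes the kernel integrable near the origin
    because [alpha < kappa], and [0 < alpha] makes it integrable at infinity. *)
Lemma kernel_weight_integral (alpha kappa : R) : 0 < alpha < kappa ->
  exists2 J : R, 0 <= J &
  (\int[mu]_(h in [set h | h != 0%R])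
    (Num.min 1 (`|h| `^ kappa) / enorm h `^ (d%:R + alpha))%:E <= J%:E)%E.
Proof.
move=> /andP[a0 ak]; have k0 : 0 < kappa by rewrite (lt_trans a0).
set e := d%:R + alpha; have e0 : 0 < e by rewrite ltr_wpDl.
pose f h := Num.min 1 (`|h| `^ kappa) / enorm h `^ e.
have f0 h : 0 <= f h by rewrite divr_ge0 ?powR_ge0// le_min ler01 powR_ge0.
have mf (D : set V) : measurable D -> measurable_fun D f.
  by move=> mD; apply: measurable_funTS; exact: measurable_kernel_weight.
have fE h : h != 0 -> f h <= Num.min 1 (`|h| `^ kappa) / `|h| `^ e.
  move=> h0; rewrite ler_wpM2l ?le_min ?ler01 ?powR_ge0//.
  rewrite lef_pV2 ?posrE ?powR_gt0 ?enorm_gt0 ?normr_gt0//.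
  by apply: ge0_ler_powR; rewrite ?nnegrE ?sqrtr_ge0 ?(ltW e0)//; exact: enorm_ge.
have mD1 : measurable ([set h : V | h != 0] `&` cube 0 1).
  by apply: measurableI; [exact: measurable_neq0_rV|exact: measurable_cube].
have mD2 : measurable (~` cube 0 1 : set V).
  by apply: measurableC; exact: measurable_cube.
have powX (x : R) (j : nat) : (2 `^ x) ^+ j = 2 `^ (x * j%:R).
  by rewrite powRrM powR_mulrn// powR_ge0.
have H1 : (\int[mu]_(h in [set h : V | h != 0%R] `&` cube 0 1) (f h)%:E <=
    ((2 `^ (e + d%:R)) / (1 - 2 `^ (alpha - kappa)))%:E)%E.
  apply: (@integral_cubes_le (fun j => 2 `^ (e * j.+1%:R - kappa * j%:R))
    (fun j => 2 `^ (- j%:R))) => //; try by move=> *; exact: powR_ge0.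
  - by rewrite powR_gt0// -[X in _ < X](powRr0 2) gt1_ltr_powR ?ltr1n// subr_lt0.
  - move=> j; rewrite -[X in (X * _) ^+ d](@powRr1 R)// -!pow2D !powX -!pow2D.
    by rewrite ler_powR ?ler1n// /e -natr1 le_eqVlt; apply/orP; left; apply/eqP; ring.
  - exact: mf.
  move=> h [/= h0 h1]; rewrite /cube/= subr0 in h1.
  have n0 : 0 < `|h| by rewrite normr_gt0.
  have [|j /andP[hj jh]] := @dyadic_between `|h|^-1; first by rewrite invf_ge1.
  have jle : `|h| <= 2 `^ (- j%:R).
    by rewrite powR_invn// -[leLHS]invrK lef_pV2 ?posrE ?invr_gt0 ?exprn_gt0.
  have jlt : 2 `^ (- j.+1%:R) < `|h|.
    by rewrite powR_invn// -[ltRHS]invrK ltf_pV2 ?posrE ?invr_gt0 ?exprn_gt0.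
  exists j => //; apply: le_trans (fE _ h0) _.
  rewrite pow2D mulrC; apply: ler_pM; rewrite ?invr_ge0 ?powR_ge0//.
  - rewrite [X in _ <= _ `^ X](_ : _ = (- j.+1%:R) * (- e)); last by ring.
    by rewrite powRrM (powRN _ e) lef_pV2 ?posrE ?powR_gt0//; apply: ge0_ler_powR;
      rewrite ?nnegrE ?powR_ge0 ?(ltW e0) ?(ltW jlt).
  rewrite ge_min; apply/orP; right.
  rewrite mulrC -mulNr powRrM.
  by apply: ge0_ler_powR; rewrite ?nnegrE ?powR_ge0 ?(ltW k0).
have H2 : (\int[mu]_(h in ~` cube 0 1 : set V) (f h)%:E <=
    ((2 `^ (d%:R + d%:R)) / (1 - 2 `^ (- alpha)))%:E)%E.
  apply: (@integral_cubes_le (fun j => 2 `^ (- (e * j%:R)))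
    (fun j => 2 `^ (j.+1%:R))) => //; try by move=> *; exact: powR_ge0.
  - by rewrite powR_gt0// -[X in _ < X](powRr0 2) gt1_ltr_powR ?ltr1n// oppr_lt0.
  - move=> j; rewrite -[X in (X * _) ^+ d](@powRr1 R)// -!pow2D !powX -!pow2D.
    by rewrite ler_powR ?ler1n// /e -natr1 le_eqVlt; apply/orP; left; apply/eqP; ring.
  - exact: mf.
  move=> h /= /negP; rewrite /cube/= subr0 -ltNge => h1.
  have n0 : 0 < `|h| by rewrite (lt_trans _ h1).
  have [|j /andP[hj jh]] := @dyadic_between `|h|; first exact: ltW.
  exists j; first by rewrite powR_mulrn// ltW.
  apply: le_trans (fE _ _) _; first by rewrite -normr_gt0.
  rewrite -[leRHS]mul1r; apply: ler_pM; rewrite ?invr_ge0 ?powR_ge0//.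
  rewrite powRN lef_pV2 ?posrE ?powR_gt0// mulrC powRrM.
  by apply: ge0_ler_powR; rewrite ?nnegrE ?powR_ge0 ?(ltW e0) ?powR_mulrn ?exprn_ge0.
pose J := 2 `^ (e + d%:R) / (1 - 2 `^ (alpha - kappa))
          + 2 `^ (d%:R + d%:R) / (1 - 2 `^ (- alpha)).
exists (Num.max 0 J); first by rewrite le_max lexx.
apply: (@le_trans _ _ J%:E); last by rewrite lee_fin le_max lexx orbT.
rewrite (_ : [set h : V | h != 0] =
    ([set h : V | h != 0] `&` cube 0 1) `|` ~` cube 0 1).
  rewrite ge0_integral_setU//.
  - by rewrite /J EFinD leeD.
  - by apply/measurable_EFinP; apply: mf; exact: measurableU.
  - by move=> h _; rewrite lee_fin f0.
  - by apply/disj_setPCl; apply: subIsetr.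
apply/seteqP; split => h /=.
  by move=> h0; have [|] := pselect (cube 0 1 h); [left|right].
case=> [[]//|]; apply: contra_not_neq => ->.
by rewrite /cube/= subrr normr0.
Qed.

End kernel.

(** * Maximum principle for differences *)

Section maximum_principle.
Context {R : realType} {d : nat}.
Local Notation V := 'rV[R]_d.
Implicit Types (g u : V -> R) (k x y h : V) (ks : seq V).

Lemma powR_le_rescale (a b t r : R) : 0 < t <= r -> a <= b ->
  t `^ b <= r `^ (b - a) * t `^ a.
Proof.
move=> /andP[t0 tr] ab.
have -> : t `^ b = t `^ (b - a) * t `^ a.
  by rewrite -powRD ?subrK// (gt_eqF t0) implybT.
by rewrite ler_wpM2r ?powR_ge0//; apply: ge0_ler_powR;
  rewrite ?nnegrE ?subr_ge0 ?(ltW t0) ?(le_trans (ltW t0) tr).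
Qed.

Lemma powR_le1 (a t : R) : 0 <= a -> 0 <= t <= 1 -> t `^ a <= 1.
Proof.
move=> a0 /andP[t0 t1]; have -> : 1 = 1 `^ a :> R by rewrite powR1.
by apply: ge0_ler_powR; rewrite ?nnegrE.
Qed.

Lemma fdiffsC ks ls u : fdiffs ks (fdiffs ls u) = fdiffs ls (fdiffs ks u).
Proof. by elim: ks => //= k ks ->; rewrite fdiffs_fdiff. Qed.

(** The difference with doubled increments, at most [Z * (2 * r) `^ gam], is
    [2 ^ N] times an average of undoubled ones; as [gam < N], one of the latter
    falls below the bound [Z * r `^ gam] by a definite proportion. *)
Lemma exists_low_fdiffs N (gam lam Z r : R) ks u x :
  0 < Z -> 0 < r -> size ks = N -> bounded_by r ks ->
  2 `^ (gam - N%:R) < lam ->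
  fdiffs_bounded N (2 * r) (Z * (2 * r) `^ gam) u ->
  exists2 y, `|y| <= N%:R * r & fdiffs ks u (x + y) < lam * (Z * r `^ gam).
Proof.
move=> Z0 r0 sks wks lamN uZ; apply/not_exists2P => H.
have : 2 ^+ size ks * (lam * (Z * r `^ gam)) <= fdiffs [seq 2 *: k | k <- ks] u x.
  apply: (fdiffs_double_ge (ltW r0) wks) => y; rewrite sks => yr.
  by have [|/negP] := H y; rewrite -?leNgt.
have := uZ [seq 2 *: k | k <- ks] x; rewrite size_map => /(_ sks (bounded_by_double wks)).
rewrite powRM ?(ltW r0)// => /(le_trans (ler_norm _)) h1 /le_trans /(_ h1).
rewrite sks (_ : 2 `^ gam = 2 ^+ N * 2 `^ (gam - N%:R)); last first.
  by rewrite -powR_mulrn// -powRD ?pnatr_eq0 ?implybT// addrC subrK.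
set T := r `^ gam; have T0 : 0 < T by rewrite powR_gt0.
have -> : Z * (2 ^+ N * 2 `^ (gam - N%:R) * T) =
  2 ^+ N * (2 `^ (gam - N%:R) * (Z * T)) by ring.
rewrite ler_pM2l ?exprn_gt0// ler_pM2r ?mulr_gt0//.
by rewrite leNgt lamN.
Qed.

(** The difference [v] is bounded by [Z * r `^ gam] and its own differences of
    order [N] decay, so Marchaud's inequality gives it a modulus of continuity
    at scale [r]; this spreads the drop of [v] at one point to a cube. *)
Lemma fdiffs_equicontinuous N (gam e : R) : (0 < N)%N -> 0 < gam -> 0 < e ->
  exists2 rho : R, 0 < rho <= 1 &
  forall u (Z r : R) ks x h, 0 <= Z -> 0 < r -> size ks = N -> bounded_by r ks ->
  (forall t : R, 0 < t -> fdiffs_bounded N t (Z * t `^ gam) u) ->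
  `|h| <= rho * r -> `|fdiffs ks u (x + h) - fdiffs ks u x| <= e * (Z * r `^ gam).
Proof.
move=> N0 g0 e0.
set s := Num.min gam (1 / 2).
have s0 : 0 < s by rewrite lt_min g0 divr_gt0.
have s1 : 0 <= s < 1%:R.
  by rewrite ltW//= gt_min; apply/orP; right; rewrite ltr_pdivrMr//; lra.
have sg : s <= gam by rewrite ge_min lexx.
have [C C1 CP] := @marchaud R V N.-1 1 s s1.
have C0 : 0 <= C by apply: le_trans C1.
have CN0 : 0 <= C * (2 ^+ N + 1) by rewrite mulr_ge0// addr_ge0// exprn_ge0.
have [t t0 tP] := powR_small s0 CN0 e0.
exists (Num.min t 1); first by rewrite lt_min t0 ltr01 ge_min lexx orbT.
move=> u Z r ks x h Z0 r0 sks wks uZ hr.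
have T0 : 0 <= r `^ gam by exact: powR_ge0.
have rg : r `^ gam * r `^ (- s) = r `^ (gam - s).
  by rewrite powRD// (gt_eqF r0) implybT.
set rho := Num.min t 1 in hr.
have rho0 : 0 < rho by rewrite lt_min t0 ltr01.
have rhor : 0 < rho * r <= r.
  by rewrite mulr_gt0//= ger_pMl// ge_min lexx orbT.
have vC : fdiffs_bounded 1 (rho * r) (C * (2 ^+ N * Z * r `^ (gam - s) +
    Z * r `^ gam * r `^ (- s)) * (rho * r) `^ s) (fdiffs ks u).
  apply: CP => //.
  - by rewrite !mulr_ge0 ?exprn_ge0 ?powR_ge0.
  - by rewrite mulr_ge0.
  - by move=> y; apply: uZ.
  - move=> t' t'r ls y; rewrite addn1 prednK// => sls wls.
    rewrite fdiffsC; have [t'0 _] := andP t'r.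
    have t'0' : 0 <= t' by exact: ltW.
    have B0 : 0 <= Z * t' `^ gam by rewrite mulr_ge0 ?powR_ge0.
    apply: (@le_trans _ _ (2 ^+ N * (Z * t' `^ gam))).
      rewrite -{1}sks; apply: (@fdiffs_le _ _ _ _ _ r) => //; first exact: ltW.
      by move=> z _; apply: uZ.
    rewrite -!mulrA ler_wpM2l ?exprn_ge0// ler_wpM2l//.
    by rewrite powR_le_rescale.
have := vC [:: h] x erefl; rewrite /= hr => /(_ isT) /le_trans; apply.
rewrite -rg powRM ?(ltW rho0) ?(ltW r0)//.
have -> : C * (2 ^+ N * Z * (r `^ gam * r `^ (- s)) + Z * r `^ gam * r `^ (- s)) *
   (rho `^ s * r `^ s) = C * (2 ^+ N + 1) * rho `^ s * (Z * r `^ gam) *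
   (r `^ (- s) * r `^ s) by ring.
rewrite -powRD ?addNr ?powRr0 ?mulr1 ?(gt_eqF r0) ?implybT//.
rewrite ler_wpM2r ?mulr_ge0//.
by apply: tP; rewrite ltW//= ge_min lexx.
Qed.

(** Near the origin the increments are small relatively to the weight of
    exponent [kap'] because they are bounded by that of exponent [kap], and
    away from it because [v] almost attains its supremum at [x0].  The linear
    part is dominated in both directions [h] and [- h] by the increments of [v]
    up to [O (s `^ kap)] at scale [s], whence its smallness as [kap > 1]. *)
Lemma near_maximum (comp : bool) (kap kap' B E : R) (v : V -> R)
    (p : V -> V -> R) :
  0 < kap' < kap -> (comp -> 1 < kap) -> 0 <= E ->
  (forall x, v x <= B) ->
  (forall x h (c : R), p x (c *: h) = c * p x h) ->
  (forall x h, h != 0 ->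
    `|v (x + h) - v x - (comp && (enorm h <= 1))%:R * p x h|
      <= E * Num.min 1 (`|h| `^ kap)) ->
  forall x e, 0 < e -> exists x0, [/\ v x - e <= v x0,
    forall h, h != 0 ->
      v (x0 + h) - v x0 - (comp && (enorm h <= 1))%:R * p x0 h
        <= e * Num.min 1 (`|h| `^ kap') &
    forall h, (comp && (enorm h <= 1))%:R * `|p x0 h| <= e].
Proof.
move=> /andP[k'0 k'k] ck E0 vB pZ vE x e e0.
have k0 : 0 < kap by apply: lt_trans k'k.
have [rh rh0 rhP] : exists2 t : R, 0 < t & forall s : R, 0 <= s <= t ->
    E * s `^ (kap - kap') <= e.
  by apply: powR_small; rewrite ?subr_gt0.
set rho := Num.min rh 1.
have rho0 : 0 < rho by rewrite lt_min rh0 ltr01.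
have rho1 : rho <= 1 by rewrite ge_min lexx orbT.
set e1 := Num.min e (e * rho `^ kap') / 2.
have e10 : 0 < e1 by rewrite divr_gt0// lt_min e0 mulr_gt0// powR_gt0.
have e1e : 2 * e1 <= e by rewrite mulrC divfK// ge_min lexx.
have e1r : 2 * e1 <= e * rho `^ kap' by rewrite mulrC divfK// ge_min lexx orbT.
have [s [s0 s1 sP]] : exists s : R, [/\ 0 < s, s <= 1 &
    comp -> E * s `^ kap <= s * (e1 / 2)].
  case: (comp) ck => [/(_ isT) k1|_]; last by exists 1.
  have [||t t0 tP] := @powR_small R E (kap - 1) (e1 / 2) _ E0.
  - by rewrite subr_gt0.
  - by rewrite divr_gt0.
  exists (Num.min t 1); rewrite lt_min t0 ltr01 ge_min lexx orbT; split=> // _.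
  set s := Num.min t 1; have s0 : 0 < s by rewrite lt_min t0 ltr01.
  rewrite -(mulr_powRB1 (ltW s0) k0) mulrCA ler_pM2l// tP//.
  by rewrite (ltW s0)/= ge_min lexx.
set ep := Num.min e1 (s * (e1 / 2)).
have ep0 : 0 < ep by rewrite lt_min e10 mulr_gt0// divr_gt0.
have supv : has_sup (range v).
  by split; [exists (v x), x|exists B => _ [y _ <-]].
have [_ [x0 _ <-] x0S] := sup_adherent ep0 supv.
set S := sup (range v) in x0S.
have vS y : v y <= S by apply: sup_upper_bound => //; exists y.
have inc h : v (x0 + h) - v x0 <= ep by have := vS (x0 + h); lra.
have pe h : (comp && (enorm h <= 1))%:R * `|p x0 h| <= e1.
  case: (boolP (comp && _)) => [/andP[c h1]|_]; last by rewrite mul0r ltW.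
  rewrite mul1r.
  have [->|h0] := eqVneq h 0.
    by have := pZ x0 0 0; rewrite scaler0 mul0r => ->; rewrite normr0 ltW.
  suff H l : l != 0 -> enorm l <= 1 -> p x0 l <= e1.
    rewrite ler_norml lerNl H// andbT -mulN1r -pZ H// ?scaleN1r ?oppr_eq0//.
    by rewrite /enorm; under eq_bigr do rewrite mxE sqrrN.
  move=> l0 l1.
  have sl0 : s *: l != 0 by rewrite scaler_eq0 negb_or gt_eqF.
  have nl : `|l| <= 1 by apply: le_trans l1; exact: enorm_ge.
  have sl1 : enorm (s *: l) <= 1.
    rewrite (@le_trans _ _ (s * enorm l))//; last by rewrite mulr_ile1// ?sqrtr_ge0// ltW.
    rewrite /enorm -[in leRHS](ger0_norm (ltW s0)) -sqrtr_sqr -sqrtrM ?sqr_ge0//.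
    by rewrite ler_wsqrtr// mulr_sumr ler_sum// => i _; rewrite mxE exprMn.
  have := vE x0 _ sl0; rewrite c sl1 mul1r pZ ler_norml => /andP[+ _].
  have : E * Num.min 1 (`|s *: l| `^ kap) <= s * (e1 / 2).
    apply: le_trans (sP c); rewrite ler_wpM2l// ge_min; apply/orP; right.
    apply: ge0_ler_powR; rewrite ?nnegrE ?(ltW k0) ?(ltW s0)//.
    by rewrite normrZ (ger0_norm (ltW s0)) ger_pMr.
  have := inc (s *: l); have : ep <= s * (e1 / 2) by rewrite ge_min lexx orbT.
  move=> h2 h3 h4 h5; rewrite -(ler_pM2l s0).
  lra.
have ep1 : ep <= e1 by rewrite ge_min lexx.
exists x0; split.
- by have := vS x; lra.
- move=> h h0.
  have [hr|hr] := leP `|h| rho.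
    apply: le_trans (ler_norm _) _; apply: le_trans (vE x0 h h0) _.
    have n0 : 0 < `|h| by rewrite normr_gt0.
    have h1 : `|h| <= 1 by apply: le_trans rho1.
    have pow1 (a : R) : 0 < a -> Num.min 1 (`|h| `^ a) = `|h| `^ a.
      by move=> a0; apply/min_idPr/powR_le1; rewrite ?normr_ge0 ?(ltW a0).
    rewrite !pow1//.
    have -> : `|h| `^ kap = `|h| `^ (kap - kap') * `|h| `^ kap'.
      by rewrite -powRD ?subrK// (gt_eqF n0) implybT.
    rewrite mulrA ler_wpM2r ?powR_ge0// rhP// normr_ge0/=.
    by rewrite (le_trans hr)// ge_min lexx.
  apply: (@le_trans _ _ (e * rho `^ kap')).
    apply: le_trans e1r; have := inc h; have := pe h.
    set c := (comp && _)%:R; have c0 : 0 <= c :> R by exact: ler0n.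
    have : - (c * p x0 h) <= c * `|p x0 h|.
      by rewrite -mulrN ler_wpM2l// -normrN ler_norm.
    lra.
  rewrite ler_pM2l// le_min; apply/andP; split.
    by apply: powR_le1; rewrite ?(ltW k'0) ?(ltW rho0).
  by apply: ge0_ler_powR; rewrite ?nnegrE ?(ltW k'0) ?(ltW rho0) ?(ltW hr).
- by move=> h; apply: le_trans (pe h) _; lra.
Qed.

End maximum_principle.

(** * Integrals against the kernel *)

Section stable_kernel.
Context {R : realType} {d : nat}.
Local Notation V := 'rV[R]_d.
Local Notation mu := (lebesgue_rV R d).
Local Notation D := [set h : 'rV[R]_d | h != 0].
Implicit Types (f a : V -> R) (ks : seq V).

Lemma integrable_kernel_weight (alpha kap : R) : 0 < alpha < kap ->
  mu.-integrable D (EFin \o (fun h =>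
    Num.min 1 (`|h| `^ kap) / enorm h `^ (d%:R + alpha))).
Proof.
move=> ak; have [J J0 HJ] := kernel_weight_integral (d := d) ak.
apply/integrableP; split.
  apply/measurable_EFinP; apply: measurable_funTS.
  exact: measurable_kernel_weight.
apply: le_lt_trans (ltry J); apply: le_trans HJ.
rewrite le_eqVlt; apply/orP; left; apply/eqP.
apply: eq_integral => h _ /=; rewrite ger0_norm// divr_ge0 ?powR_ge0//.
Qed.

Lemma kernel_integrable (alpha kap E c : R) f a : 0 < alpha < kap ->
  0 <= E -> measurable_fun setT f -> measurable_fun setT a ->
  (forall h, h != 0 -> `|f h| <= E * Num.min 1 (`|h| `^ kap)) ->
  (forall h, `|a h| <= c) ->
  mu.-integrable D (EFin \o (fun h => f h * (a h / enorm h `^ (d%:R + alpha)))) /\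
  `|\int[mu]_(h in D) (f h * (a h / enorm h `^ (d%:R + alpha)))| <=
     E * c * \int[mu]_(h in D)
       (Num.min 1 (`|h| `^ kap) / enorm h `^ (d%:R + alpha)).
Proof.
move=> ak E0 mf ma fE ac.
have mD : measurable D := measurable_neq0_rV.
have iW := integrable_kernel_weight ak.
set W := (fun h : V => Num.min 1 (`|h| `^ kap) / enorm h `^ (d%:R + alpha)) in iW *.
have iEW : mu.-integrable D (EFin \o (fun h => E * c * W h)).
  by apply: eq_integrable (integrableZl mD (E * c) iW) => //.
set g := (fun h => f h * _).
have gW h : h != 0 -> `|g h| <= E * c * W h.
  move=> h0; rewrite /g /W !normrM normfV (ger0_norm (powR_ge0 _ _)).
  rewrite !mulrA ler_wpM2r ?invr_ge0 ?powR_ge0// mulrAC.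
  by apply: ler_pM => //; exact: fE.
have mg : measurable_fun D g.
  apply: measurable_funTS; apply: measurable_funM => //.
  apply: measurable_funM => //.
  rewrite (_ : (fun h => _) = fun h : V => enorm h `^ (- (d%:R + alpha))).
    by apply: (measurableT_comp (measurable_powR _)); exact: measurable_enorm.
  by apply/funext => h; rewrite powRN.
have ig : mu.-integrable D (EFin \o g).
  apply: le_integrable iEW => //; first exact/measurable_EFinP.
  move=> h h0; rewrite /= lee_fin (le_trans (gW h h0))//; exact: ler_norm.
split => //.
apply: le_trans (le_normr_Rintegral mD ig) _.
rewrite -RintegralZl//; apply: le_Rintegral => //.
by apply: eq_integrable (integrable_abse ig).
Qed.

Lemma fdiffs_Rintegral ks (Q : V -> V -> R) :
  (forall y, mu.-integrable D (EFin \o Q y)) -> forall x,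
  mu.-integrable D (EFin \o (fun h => fdiffs ks (fun y => Q y h) x)) /\
  fdiffs ks (fun y => \int[mu]_(h in D) Q y h) x =
  \int[mu]_(h in D) fdiffs ks (fun y => Q y h) x.
Proof.
move=> iQ; have mD : measurable D := measurable_neq0_rV.
elim: ks => [|k ks IH] x /=; first by split=> //; exact: iQ.
have [i1 e1] := IH (x + k); have [i2 e2] := IH x.
split; last by rewrite {1}/fdiff e1 e2 -RintegralB.
exact: eq_integrable (integrableB mD i1 i2).
Qed.

End stable_kernel.

(** * The one-sided estimate *)

Section one_sided_estimate.
Context {R : realType} {d : nat}.
Local Notation V := 'rV[R]_d.
Local Notation mu := (lebesgue_rV R d).
Local Notation D := [set h : 'rV[R]_d | h != 0].
Implicit Types (u : V -> R) (ks : seq V) (x y h : V).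

(** The bracket in the integrand of the operator, [p] being the linear part:
    [comp] selects the compensated form, and [p] is an arbitrary function so
    that differences of increments are increments too. *)
Definition increment (comp : bool) u (p : V -> V -> R) y h : R :=
  u (y + h) - u y - (comp && (enorm h <= 1))%:R * p y h.

(** Increments commute with differences, so that no derivative of [fdiffs ks u]
    has to be considered. *)
Lemma fdiffs_increment comp u p ks x h :
  fdiffs ks (fun y => increment comp u p y h) x =
  increment comp (fdiffs ks u) (fun y h => fdiffs ks (p ^~ h) y) x h.
Proof.
rewrite /increment fdiffsD fdiffsN fdiffsZ fdiffsD fdiffsN.
by rewrite (fdiffs_shift ks u).
Qed.

(** The origin is negligible, as a cube of radius 0. *)
Lemma lebesgue_punctured_cube y (r : R) : (0 < d)%N -> 0 < r ->
  ((2 * r) ^+ d)%:E = mu (cube y r `&` D).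
Proof.
move=> hd r0; have mC := measurable_cube y (ltW r0).
have mD : measurable D := measurable_neq0_rV.
rewrite -(lebesgue_rV_cube y (ltW r0)) -[in LHS](setUIDK (cube y r) D).
rewrite [LHS]measureU//.
- rewrite -[RHS]adde0; congr (_ + _)%E.
  have : (mu (cube y r `\` D) <= mu (cube (0 : V) 0))%E.
    apply: le_measure; rewrite ?inE; [exact: measurableD|exact: measurable_cube|].
    move=> h [_ /= /negP]; rewrite negbK => /eqP ->.
    by rewrite /cube/= subrr normr0.
  rewrite lebesgue_rV_cube// mulr0 expr0n gt_eqF//.
  by move=> h; apply/eqP; rewrite eq_le h measure_ge0.
- exact: measurableI.
- exact: measurableD.
- by apply/seteqP; split => h // -[[_ ?] [_ /=]].
Qed.

(** The operator with coefficients frozen at an almost maximum [x0] of the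
    difference [v] is very negative on [v], which drops by a definite amount on
    a cube whose radius and distance to [x0] are comparable to [r]; but its
    value is also a difference of values of the operator on [u], up to the
    modulus of continuity of the coefficients. *)
Lemma fdiffs_estimate (alpha beta kap' a1 a2 a3 : R) N :
  (0 < d)%N -> 0 < alpha < kap' -> 0 < beta -> (0 < N)%N ->
  alpha + beta < N%:R -> 0 < a1 -> 0 < a2 -> 0 < a3 ->
  exists2 C : R, 0 <= C &
  forall (A : V -> V -> R) (comp : bool) u F (p : V -> V -> R) (kap E E2 H Z r : R) ks x,
  (forall y, measurable_fun setT (A y)) ->
  (forall y h, a1 <= A y h <= a2) ->
  (forall k y h, `|A (y + k) h - A y h| <= a3 * enorm k `^ beta) ->
  kap' < kap -> (comp -> 1 < kap) ->
  0 <= E -> 0 <= E2 -> 0 <= H -> 0 <= Z -> 0 < r ->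
  size ks = N -> bounded_by r ks ->
  (forall y, measurable_fun setT (increment comp u p y)) ->
  (forall y h (c : R), p y (c *: h) = c * p y h) ->
  (forall y h, h != 0 -> `|increment comp u p y h| <= E * Num.min 1 (`|h| `^ kap')) ->
  (forall y h, h != 0 -> `|increment comp u p y h| <= E2 * Num.min 1 (`|h| `^ kap)) ->
  (forall t : R, 0 < t -> fdiffs_bounded N t (Z * t `^ (alpha + beta)) u) ->
  (forall y, F y = \int[mu]_(h in D)
     (increment comp u p y h * (A y h / enorm h `^ (d%:R + alpha)))) ->
  (forall y k, `|F (y + k) - F y| <= H * `|k| `^ beta) ->
  (1 + 2 `^ (alpha + beta - N%:R)) / 2 * (Z * r `^ (alpha + beta)) <= fdiffs ks u x ->
  Z <= C * (H + E).
Proof.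
move=> hd /andP[al0 alk] be0 N0 gN a10 a20 a30.
set gam := alpha + beta in gN *.
have gam0 : 0 < gam by rewrite addr_gt0.
set lam : R := 2 `^ (gam - N%:R).
have lam1 : lam < 1.
  by rewrite -[X in _ < X](powRr0 2) gt1_ltr_powR ?ltr1n// subr_lt0.
set e := d%:R + alpha; have e0 : 0 < e by rewrite ltr_wpDl.
have [g g0 gE] : exists2 g : R, 0 < g & 16 * g = 1 - lam.
  by exists ((1 - lam) / 16); [rewrite divr_gt0// subr_gt0|field].
have [rho /andP[rho0 rho1] rhoP] := @fdiffs_equicontinuous R d N gam g N0 gam0 g0.
pose W := (fun h : V => Num.min 1 (`|h| `^ kap') / enorm h `^ e).
have akk : 0 < alpha < kap' by rewrite al0.
have iW : mu.-integrable D (EFin \o W) by exact: integrable_kernel_weight.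
pose J := \int[mu]_(h in D) W h.
have W0 h : 0 <= W h.
  by rewrite /W divr_ge0 ?powR_ge0// le_min ler01 powR_ge0.
have J0 : 0 <= J by exact: Rintegral_ge0.
have [L L0 LE] : exists2 L : R, 0 < L & L = d.+1%:R * (N%:R + 1).
  by exists (d.+1%:R * (N%:R + 1)); rewrite // mulr_gt0// ltr_wpDl.
pose c1 := g * a1 * L `^ (- e) * (2 * rho) ^+ d.
have c10 : 0 < c1.
  by rewrite !mulr_gt0 ?powR_gt0// exprn_gt0// mulr_gt0.
pose c2 := 2 ^+ N + 2 ^+ N * (a3 * L `^ beta * J).
have c20 : 0 <= c2.
  by rewrite addr_ge0 ?mulr_ge0 ?exprn_ge0 ?powR_ge0// ltW.
have C0 : 0 <= 2 * c2 / c1 by apply: divr_ge0; rewrite ?(ltW c10)// mulr_ge0.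
exists (2 * c2 / c1) => //.
move=> A comp u F p kap E E2 H Z r ks x mA hA hH kk' ck E0 E20 H0 Z0 r0 sks wks mq
  pZ qE qE2 uZ FE FH vx.
have [->|Zn0] := eqVneq Z 0; first by rewrite (mulr_ge0 C0)// addr_ge0.
have {Zn0}Zp : 0 < Z by rewrite lt_neqAle eq_sym Zn0.
pose v := fdiffs ks u; pose pv y h := fdiffs ks (p ^~ h) y.
set T := Z * r `^ gam in vx.
have T0 : 0 < T by rewrite mulr_gt0// powR_gt0.
have vT y : `|v y| <= T by apply: uZ.
(* The first bound keeps the drop of [v] on the cube; with the second one the
   positive part of the integral costs at most half of what the cube gains. *)
set B := c1 * (Z * r `^ beta).
have B0 : 0 < B by rewrite (mulr_gt0 c10)// mulr_gt0// powR_gt0.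
pose eps := Num.min (g * T) (B / (2 * (a2 * J + 1))).
have aJ : 0 < 2 * (a2 * J + 1) by rewrite mulr_gt0// ltr_wpDl// mulr_ge0// ltW.
have eps0 : 0 < eps by rewrite lt_min mulr_gt0//= divr_gt0.
have [|||||x0 [x0v x0inc x0p]] := @near_maximum R d comp kap kap' T (2 ^+ N * E2) v pv
    _ ck _ _ _ _ x eps eps0.
- by rewrite (lt_trans al0).
- by rewrite mulr_ge0// exprn_ge0.
- by move=> y; apply: le_trans (ler_norm _) (vT y).
- by move=> y h c; rewrite /pv; under [in LHS]eq_fun do rewrite pZ; rewrite fdiffsZ.
- move=> y h h0; rewrite -[X in `|X|]/(increment comp v pv y h) -fdiffs_increment.
  rewrite -mulrA -[in X in X * _]sks; apply: (@fdiffs_le _ _ _ _ _ r) => //; first exact: ltW.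
  by move=> z _; exact: qE2.
have [||y yr vy] := @exists_low_fdiffs R d N gam (lam + g) Z r ks u x0 Zp r0 sks wks.
- by rewrite ltrDl.
- by apply: uZ; rewrite mulr_gt0.
have low h : cube y (rho * r) h -> increment comp v pv x0 h <= - (g * T).
  move=> yh.
  have := rhoP u Z r ks (x0 + y) (h - y) Z0 r0 sks wks uZ yh.
  rewrite -addrA subrKC => /(le_trans (ler_norm _)); rewrite -/T => h1.
  rewrite -/T in vy.
  have h2 : eps <= g * T by rewrite ge_min lexx.
  have := x0p h; rewrite /increment; set c := (comp && _)%:R => h3.
  have c0 : 0 <= c :> R by exact: ler0n.
  have h4 : - (c * pv x0 h) <= c * `|pv x0 h|.
    by rewrite -mulrN ler_wpM2l// -normrN ler_norm.
  have E1 : (1 + lam) / 2 * T = lam * T + 8 * (g * T).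
    have -> : (1 + lam) / 2 = lam + 8 * g by lra.
    by ring.
  rewrite mulrDl in vy; rewrite -/v in h1 vy; rewrite E1 -/v in vx.
  lra.
have mD : measurable D := measurable_neq0_rV.
pose k h := A x0 h / enorm h `^ e.
have A0 z h : 0 <= A z h by have /andP[/(lt_le_trans a10)/ltW] := hA z h.
have An z h : `|A z h| <= a2 by rewrite ger0_norm//; have /andP[] := hA z h.
have k0 h : 0 <= k h by rewrite divr_ge0 ?powR_ge0.
pose Q z h := increment comp u p z h * k h.
have iQ z : mu.-integrable D (EFin \o Q z).
  by have [] := kernel_integrable akk E0 (mq z) (mA x0) (qE z) (An x0).
have [iv ev] := fdiffs_Rintegral ks iQ x0.
have QE h : fdiffs ks (fun z => Q z h) x0 = increment comp v pv x0 h * k h.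
  rewrite -fdiffs_increment /Q; under [in LHS]eq_fun do rewrite mulrC.
  by rewrite fdiffsZ mulrC.
(* On the cube the argument of the kernel has norm at most [(N + 1) * r]. *)
set b := a1 / (L * r) `^ e.
have b0 : 0 < b by rewrite divr_gt0// powR_gt0// mulr_gt0.
have kb h : cube y (rho * r) h -> h != 0 -> b <= k h.
  move=> yh h0; apply: ler_pM => //; rewrite ?invr_ge0 ?powR_ge0 ?(ltW a10)//.
    by have /andP[] := hA x0 h.
  rewrite lef_pV2 ?posrE ?powR_gt0 ?enorm_gt0// ?mulr_gt0//.
  apply: ge0_ler_powR; rewrite ?nnegrE ?(ltW e0) ?sqrtr_ge0 ?mulr_ge0 ?(ltW L0) ?(ltW r0)//.
  apply: le_trans (enorm_le h) _; rewrite LE -mulrA.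
  apply: ler_pM => //; first by rewrite ler_nat.
  rewrite -[h](subrK y) (le_trans (ler_normD _ _))// mulrDl mul1r addrC lerD//.
  by rewrite (le_trans yh)// ler_piMl// ltW.
have mS : measurable (cube y (rho * r)).
  by apply: measurable_cube; rewrite mulr_ge0// ltW.
pose S := cube y (rho * r).
have SD : mu (S `&` D) = ((2 * (rho * r)) ^+ d)%:E.
  by apply: esym; apply: lebesgue_punctured_cube => //; rewrite mulr_gt0.
have iS : mu.-integrable D (EFin \o (\1_S : V -> R)).
  apply/integrableP; split.
    by apply/measurable_EFinP; apply: measurable_indic.
  rewrite (eq_integral (fun h => (\1_S h)%:E)); last first.
    by move=> h _ /=; rewrite ger0_norm.
  by rewrite integral_indic// [X in (X < _)%E]SD ltry.
have IS : \int[mu]_(h in D) (\1_S h : R) = (2 * (rho * r)) ^+ d.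
  by rewrite /Rintegral integral_indic// [X in fine X]SD.
have iUp : mu.-integrable D (EFin \o (fun h => eps * a2 * W h - g * T * b * \1_S h)).
  apply: eq_integrable (integrableB mD (integrableZl mD (eps * a2) iW)
    (integrableZl mD (g * T * b) iS)) => //.
have up : \int[mu]_(h in D) fdiffs ks (fun z => Q z h) x0 <=
    eps * a2 * J - g * T * b * (2 * (rho * r)) ^+ d.
  rewrite -IS -RintegralZl// -RintegralZl// -RintegralB//; last 2 first.
  - by apply: eq_integrable (integrableZl mD (eps * a2) iW).
  - by apply: eq_integrable (integrableZl mD (g * T * b) iS).
  apply: le_Rintegral => // h /= h0; rewrite QE.
  have eW : 0 <= eps * a2 * W h.
    exact: mulr_ge0 (mulr_ge0 (ltW eps0) (ltW a20)) (W0 h).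
  rewrite indicE; case: (boolP (h \in S)) => [|_].
    rewrite inE => Sh; rewrite mulr1.
    have l1 : increment comp v pv x0 h * k h <= - (g * T) * k h.
      by rewrite ler_wpM2r// low.
    have l2 : g * T * b <= g * T * k h by rewrite ler_wpM2l ?kb// mulr_ge0// ltW.
    lra.
  rewrite mulr0 subr0.
  apply: (@le_trans _ _ (eps * Num.min 1 (`|h| `^ kap') * k h)).
    by rewrite ler_wpM2r// x0inc.
  rewrite /k /W -!mulrA ler_wpM2l ?(ltW eps0)// mulrCA.
  rewrite ler_wpM2r//; last by have /andP[] := hA x0 h.
  by rewrite mulr_ge0 ?invr_ge0 ?powR_ge0// le_min ler01 powR_ge0.
(* [G z] and [F z] differ by the oscillation of the coefficients between [x0]
   and [z], which is [O (r `^ beta)] on the points that the difference sees. *)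
pose G z := \int[mu]_(h in D) Q z h.
have GF z : `|z - x0| <= N%:R * r -> `|G z - F z| <= a3 * L `^ beta * J * E * r `^ beta.
  move=> zx.
  have iF : mu.-integrable D (EFin \o (fun h => increment comp u p z h *
      (A z h / enorm h `^ e))).
    by have [] := kernel_integrable akk E0 (mq z) (mA z) (qE z) (An z).
  rewrite /G FE -RintegralB//.
  have mAA : measurable_fun setT (fun h => A x0 h - A z h).
    exact: measurable_funB.
  have AA h : `|A x0 h - A z h| <= a3 * (L `^ beta * r `^ beta).
    rewrite -{1}[x0](subrKC z); apply: le_trans (hH _ _ _) _.
    rewrite ler_wpM2l ?(ltW a30)// -powRM ?(ltW L0) ?(ltW r0)//.
    apply: ge0_ler_powR; rewrite ?nnegrE ?(ltW be0) ?sqrtr_ge0 ?mulr_ge0 ?(ltW L0) ?(ltW r0)//.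
    apply: le_trans (enorm_le _) _; rewrite LE -mulrA distrC.
    apply: ler_pM => //; first by rewrite ler_nat.
    by rewrite (le_trans zx)// ler_wpM2r ?(ltW r0)// lerDl.
  have [_] := kernel_integrable akk E0 (mq z) mAA (qE z) AA.
  rewrite -/J (_ : \int[mu]_(h in D) _ =
    \int[mu]_(h in D) (Q z h - increment comp u p z h * (A z h / enorm h `^ e))).
    by move=> /le_trans; apply; rewrite le_eqVlt; apply/orP; left; apply/eqP; ring.
  by apply: eq_Rintegral => h _; rewrite /Q /k; ring.
have lowF : `|fdiffs ks F x0| <= 2 ^+ N * (H * r `^ beta).
  case: (ks) sks wks => [/= s0|l ls /= [sls] /andP[lr wls]]; first by rewrite -s0 in N0.
  rewrite -fdiffs_fdiff.
  apply: (@le_trans _ _ (2 ^+ size ls * (H * r `^ beta))).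
    apply: (@fdiffs_le _ _ _ _ _ r) => // [|z _]; first exact: ltW.
    apply: le_trans (FH _ _) _; rewrite ler_wpM2l//.
    by apply: ge0_ler_powR; rewrite ?nnegrE ?(ltW be0) ?(ltW r0).
  rewrite -sls exprS ler_wpM2r ?mulr_ge0 ?powR_ge0//.
  by rewrite ler_peMl ?exprn_ge0// ler1n.
have lowG : `|fdiffs ks (fun z => G z - F z) x0| <=
    2 ^+ N * (a3 * L `^ beta * J * E * r `^ beta).
  rewrite -sks; apply: (@fdiffs_le _ _ _ _ _ r) => //; first exact: ltW.
  by rewrite sks => z zr; apply: GF; rewrite addrC addKr.
have Gle : - (c2 * (H + E) * r `^ beta) <= fdiffs ks G x0.
  have -> : fdiffs ks G x0 = fdiffs ks F x0 + fdiffs ks (fun z => G z - F z) x0.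
    rewrite -[RHS]/((fun y => fdiffs ks F y + fdiffs ks (fun z => G z - F z) y) x0).
    rewrite -fdiffsD; congr (fdiffs ks _ x0); apply/funext => z.
    by rewrite addrC subrK.
  move: lowF lowG; rewrite !ler_norml => /andP[l1 _] /andP[l2 _].
  set P := r `^ beta in l1 l2 *; have P0 : 0 <= P by exact: powR_ge0.
  set Y := 2 ^+ N in l1 l2 *; have Y0 : 0 <= Y by rewrite exprn_ge0.
  set X := a3 * L `^ beta * J in l2 *.
  have X0 : 0 <= X.
    exact: mulr_ge0 (mulr_ge0 (ltW a30) (powR_ge0 _ _)) J0.
  have -> : c2 * (H + E) * P = Y * (H * P) + Y * (X * E * P) + Y * E * P + Y * X * H * P.
    by rewrite /c2 -/Y -/X; ring.
  have h1 : 0 <= Y * E * P by rewrite !mulr_ge0.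
  have h2 : 0 <= Y * X * H * P := mulr_ge0 (mulr_ge0 (mulr_ge0 Y0 X0) H0) P0.
  lra.
move: up; rewrite -ev => /(le_trans Gle).
have -> : g * T * b * (2 * (rho * r)) ^+ d = B.
  have -> : (2 * (rho * r)) ^+ d = (2 * rho) ^+ d * r ^+ d by rewrite mulrA exprMn.
  rewrite /B /c1 /T /b powRM ?(ltW L0) ?(ltW r0)// invfM -!powRN.
  have -> : r `^ beta = r `^ gam * r `^ (- e) * r ^+ d.
    rewrite -powR_mulrn ?(ltW r0)// -!powRD ?(gt_eqF r0) ?implybT//.
    by congr (_ `^ _); rewrite /gam /e; ring.
  by ring.
have epsB : eps * a2 * J <= B / 2.
  apply: (@le_trans _ _ (B / (2 * (a2 * J + 1)) * (a2 * J + 1))).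
    rewrite -mulrA; apply: ler_pM; rewrite ?(ltW eps0) ?ge_min ?lexx ?orbT//.
      by rewrite mulr_ge0// ltW.
    by rewrite lerDl.
  by rewrite invfM !mulrA divfK// gt_eqF// ltr_wpDl// mulr_ge0// ltW.
have rb : 0 < r `^ beta by rewrite powR_gt0.
move=> fin; rewrite -(ler_pM2r rb).
have -> : 2 * c2 / c1 * (H + E) * r `^ beta = 2 * (c2 * (H + E) * r `^ beta) / c1.
  by ring.
rewrite ler_pdivlMr//.
rewrite -/B in fin *.
have -> : Z * r `^ beta * c1 = B by rewrite /B; ring.
lra.
Qed.

End one_sided_estimate.

(** * Hoelder seminorms and interpolation *)

Section holder_spaces.
Context {R : realType} {d : nat}.
Local Notation V := 'rV[R]_d.
Implicit Types (g u : V -> R) (k x y h : V) (ks : seq V) (j : seq 'I_d).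

Lemma enorm0 : enorm (0 : V) = 0.
Proof.
rewrite /enorm big1 ?sqrtr0// => i _; by rewrite mxE expr0n.
Qed.

Lemma enorm_powR_le (theta : R) h : 0 <= theta ->
  enorm h `^ theta <= d.+1%:R `^ theta * `|h| `^ theta.
Proof.
move=> th0; rewrite -powRM//; apply: ge0_ler_powR; rewrite ?nnegrE ?sqrtr_ge0 ?mulr_ge0//.
by apply: le_trans (enorm_le h) _; rewrite ler_wpM2r// ler_nat.
Qed.

Lemma powR_enorm_ge (theta : R) h : 0 <= theta -> `|h| `^ theta <= enorm h `^ theta.
Proof.
move=> th0; apply: ge0_ler_powR; rewrite ?nnegrE ?sqrtr_ge0//; exact: enorm_ge.
Qed.

Lemma holder_seminorm_fin (theta s : R) g : 0 < theta ->
  (holder_seminorm theta g <= s%:E)%E ->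
  forall x h, `|g (x + h) - g x| <= s * enorm h `^ theta.
Proof.
move=> th0 gs x h.
have [->|h0] := eqVneq h 0.
  by rewrite addr0 subrr normr0 enorm0 powR0 ?mulr0// gt_eqF.
rewrite -ler_pdivrMr ?powR_gt0 ?enorm_gt0// -lee_fin; apply: le_trans gs.
apply: (@le_trans _ _ (ereal_sup
    [set (`|g (x + h) - g x| / enorm h `^ theta)%:E | h in [set h | h != 0]])).
  by apply: ereal_sup_ubound; exists h.
by apply: ereal_sup_ubound; exists x.
Qed.

Lemma holder_seminorm_le (theta s : R) g :
  (forall x h, `|g (x + h) - g x| <= s * enorm h `^ theta) ->
  (holder_seminorm theta g <= s%:E)%E.
Proof.
move=> gs; apply: ge_ereal_sup => _ [x _ <-].
apply: ge_ereal_sup => _ [h h0 <-].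
by rewrite lee_fin ler_pdivrMr ?powR_gt0 ?enorm_gt0.
Qed.

Lemma holder_seminorm_ge0 (theta : R) g : (0 < d)%N ->
  (0 <= holder_seminorm theta g)%E.
Proof.
move=> hd; set i0 := Ordinal hd.
set h := const_mx 1 : V.
have h0 : h != 0.
  by apply/eqP => /rowP /(_ i0); rewrite !mxE => /eqP; rewrite oner_eq0.
apply: (@le_trans _ _ (`|g (0 + h) - g 0| / enorm h `^ theta)%:E).
  by rewrite lee_fin divr_ge0 ?powR_ge0.
apply: (@le_trans _ _ (ereal_sup
    [set (`|g (0 + h) - g 0| / enorm h `^ theta)%:E | h in [set h | h != 0]])).
  by apply: ereal_sup_ubound; exists h.
by apply: ereal_sup_ubound; exists 0.
Qed.

Lemma Linfty_le_holder_norm (gam : R) g : (0 < d)%N ->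
  (Linfty_norm g <= holder_norm gam g)%E.
Proof.
move=> hd; rewrite /holder_norm leeDl// sume_ge0// => j _.
exact: holder_seminorm_ge0.
Qed.

Lemma holder_seminorm_le_norm (gam : R) g (j : (Num.truncn gam).-tuple 'I_d) :
  (0 < d)%N ->
  (holder_seminorm (gam - (Num.truncn gam)%:R) (iter_partial j g)
    <= holder_norm gam g)%E.
Proof.
move=> hd; rewrite /holder_norm (bigD1 j)//= addeCA leeDl//.
rewrite adde_ge0 ?Linfty_norm_ge0// sume_ge0// => k _.
exact: holder_seminorm_ge0.
Qed.

Lemma holder_seminorm_lt1 (beta : R) g : (0 < d)%N -> 0 < beta < 1 ->
  (holder_seminorm beta g <= holder_norm beta g)%E.
Proof.
move=> hd /andP[b0 b1].
have E : Num.truncn beta = 0%N by apply: truncn_def; rewrite b1 ltW.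
have := @holder_seminorm_le_norm beta g [tuple of nseq _ (Ordinal hd)] hd.
by rewrite /= E subr0.
Qed.

(** Up to scale [r], Marchaud's inequality applies with the factor
    [r `^ (gam - kap)] in front of [Z], which tends to 0 with [r]; beyond, only
    the bound [M] is used, and the linear part is recovered by homogeneity from
    its values on vectors of norm [r]. *)
Lemma increment_interpolation (comp : bool) N (gam kap : R) :
  0 < kap <= gam -> (if comp then (1 < N)%N && (1 < kap < 2)
                     else (0 < N)%N && (kap < 1)) ->
  exists2 C : R, 0 <= C &
  forall u (M Z r : R), 0 <= M -> 0 <= Z -> 0 < r <= 1 ->
  (forall x, `|u x| <= M) -> (comp -> forall y, differentiable u y) ->
  (forall t : R, 0 < t -> fdiffs_bounded N t (Z * t `^ gam) u) ->
  forall y h, `|increment comp u (grad_dot u) y h| <=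
    C * (Z * r `^ (gam - kap) + M * r `^ (- kap)) * Num.min 1 (`|h| `^ kap).
Proof.
move=> /andP[k0 kg] compk.
have [i [iN ki ic]] : exists i : nat, [/\ (i <= N)%N, kap < i%:R & i = (if comp then 2 else 1)%N].
  by case: (comp) compk => /andP[N1]; [move=> /andP[_ k2]; exists 2%N|exists 1%N].
have ki' : 0 <= kap < i%:R by rewrite ltW.
have [C1 C11 C1P] := @marchaud R V (N - i) i kap ki'.
have C10 : 0 <= C1 by apply: le_trans C11.
have [C2 C20 C2P] : exists2 C : R, 0 <= C & comp ->
  forall u (E r : R) y h, 0 <= E -> `|h| <= r -> differentiable u y ->
  (forall t : R, 0 < t <= r -> fdiffs_bounded 2 t (E * t `^ kap) u) ->
  `|u (y + h) - u y - grad_dot u y h| <= C * E * `|h| `^ kap.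
  case: (comp) compk => [/andP[_ /andP[k1 _]]|_]; last by exists 0.
  by have [C C0 CP] := @taylor_fdiff2 R d kap k1; exists C.
pose Dk : R := d.+1%:R `^ kap.
have Dk0 : 0 <= Dk by exact: powR_ge0.
exists (C1 + C2 * C1 + 4 + 2 * Dk); first by rewrite !addr_ge0 ?mulr_ge0.
move=> u M Z r M0 Z0 /andP[r0 r1] uM du uZ y h.
set E0 := Z * _ + _.
have E00 : 0 <= E0 by rewrite addr_ge0// mulr_ge0// powR_ge0.
have rk : r `^ kap <= 1 by apply: powR_le1; rewrite ?(ltW k0) ?(ltW r0).
have rk0 : 0 < r `^ kap by rewrite powR_gt0.
have ME : M <= E0 * r `^ kap.
  rewrite mulrDl -[leLHS]add0r lerD ?mulr_ge0 ?powR_ge0//.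
  by rewrite -mulrA -powRD ?addNr ?powRr0 ?mulr1// (gt_eqF r0) implybT.
have uE t : 0 < t <= r -> fdiffs_bounded i t (C1 * E0 * t `^ kap) u.
  apply: C1P => //; first by rewrite mulr_ge0 ?powR_ge0.
  move=> t' t'r; rewrite subnK//; have [t'0 _] := andP t'r.
  apply: fdiffs_bounded_mono (uZ t' t'0) => //.
  by rewrite -mulrA ler_wpM2l// powR_le_rescale.
set W := Num.min 1 _.
have hk0 : 0 <= `|h| `^ kap by exact: powR_ge0.
have W0 : 0 <= W by rewrite le_min ler01.
have inc2M : `|u (y + h) - u y| <= 2 * M.
  by rewrite mulr2n mulrDl mul1r (le_trans (ler_normB _ _))// lerD.
have EW0 : 0 <= E0 * W by rewrite mulr_ge0.
have c1 : 0 <= C1 * (E0 * W) by rewrite mulr_ge0.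
have c2 : 0 <= C2 * C1 * (E0 * W) by rewrite !mulr_ge0.
have c3 : 0 <= Dk * (E0 * W) by rewrite mulr_ge0.
have -> : (C1 + C2 * C1 + 4 + 2 * Dk) * E0 * W = C1 * (E0 * W) +
  C2 * C1 * (E0 * W) + 4 * (E0 * W) + 2 * (Dk * (E0 * W)) by ring.
have WE : `|h| <= 1 -> W = `|h| `^ kap.
  by move=> h1; apply/min_idPr/powR_le1; rewrite ?normr_ge0 ?(ltW k0).
have far : r < `|h| -> M <= E0 * W.
  move=> hr; apply: le_trans ME _; rewrite ler_wpM2l// le_min rk/=.
  by apply: ge0_ler_powR; rewrite ?nnegrE ?(ltW k0) ?(ltW r0) ?(ltW hr).
rewrite /increment; case: (boolP (comp && _)) => [/andP[c h1]|]; last first.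
  rewrite mul0r subr0 negb_and => nc.
  have [hr|hr] := leP `|h| r; last by have := far hr; lra.
  have h1 : `|h| <= 1 by apply: le_trans r1.
  case: (boolP comp) nc => [c /= nh|nc _].
    have DW : 1 <= Dk * W.
      rewrite WE// -powRM//; rewrite -ltNge in nh.
      apply: (@le_trans _ _ (1 `^ kap)); first by rewrite powR1.
      apply: ge0_ler_powR; rewrite ?nnegrE ?(ltW k0) ?mulr_ge0//.
      by rewrite (le_trans (ltW nh))// (le_trans (enorm_le h))// ler_wpM2r// ler_nat.
    have : M <= E0.
      by apply: le_trans ME _; rewrite ler_piMr.
    have : E0 <= E0 * (Dk * W) := ler_peMr E00 DW.
    have -> : E0 * (Dk * W) = Dk * (E0 * W) by ring.
    lra.
  have i1 : i = 1%N by rewrite ic (negbTE nc).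
  have [h0|h0] := eqVneq h 0.
    by rewrite h0 addr0 subrr normr0; lra.
  have : `|fdiffs [:: h] u y| <= C1 * E0 * `|h| `^ kap.
    apply: (uE `|h|); rewrite ?i1//= ?lexx// normr_gt0 h0//.
  rewrite /= /fdiff -WE// -mulrA; lra.
rewrite mul1r.
have i2 : i = 2%N by rewrite ic c.
have CE0 : 0 <= C1 * E0 by rewrite mulr_ge0.
have tay l : `|l| <= r -> `|u (y + l) - u y - grad_dot u y l| <=
    C2 * (C1 * E0) * `|l| `^ kap.
  move=> lr; apply: (C2P c _ _ r) => //; first exact: du.
  by move=> t tr; rewrite -i2; apply: uE.
have h1' : `|h| <= 1 by apply: le_trans h1; exact: enorm_ge.
have [hr|hr] := leP `|h| r.
  have := tay h hr; rewrite -WE// -!mulrA => tayh.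
  have := c2; rewrite -!mulrA => c2'.
  lra.
have n0 : 0 < `|h| by rewrite (lt_trans r0).
pose l := (r / `|h|) *: h.
have rh0 : 0 <= r / `|h| by rewrite divr_ge0// ltW.
have nl : `|l| = r by rewrite /l normrZ ger0_norm// divfK// gt_eqF.
have gl : grad_dot u y h = (`|h| / r) * grad_dot u y l.
  rewrite /grad_dot mulr_sumr; apply: eq_bigr => i' _; rewrite /l mxE.
  by field; rewrite !gt_eqF.
have gr : `|grad_dot u y l| <= 2 * M + C2 * (C1 * E0) * r `^ kap.
  have := tay l; rewrite nl => /(_ (lexx r)) tl.
  rewrite -[X in `|X|](subKr (u (y + l) - u y)).
  rewrite (le_trans (ler_normB _ _))// lerD//.
  by rewrite mulr2n mulrDl mul1r (le_trans (ler_normB _ _))// lerD.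
have hrk : `|h| / r * r `^ kap <= W.
  have hr0 : 0 <= `|h| / r by rewrite divr_ge0// ltW.
  have -> : W = (`|h| / r) `^ kap * r `^ kap.
    by rewrite WE// -powRM ?(ltW r0)// divfK// gt_eqF.
  rewrite ler_wpM2r ?(ltW rk0)// le1r_powR//.
    by rewrite ler_pdivlMr// mul1r ltW.
  by have := compk; rewrite c => /andP[_ /andP[/ltW]].
have gh : `|grad_dot u y h| <= (2 + C2 * C1) * (E0 * W).
  have hr0 : 0 <= `|h| / r by rewrite divr_ge0// ltW.
  rewrite gl normrM (ger0_norm hr0).
  apply: (@le_trans _ _ (`|h| / r * ((2 + C2 * C1) * E0 * r `^ kap))).
    have -> : (2 + C2 * C1) * E0 * r `^ kap =
      2 * (E0 * r `^ kap) + C2 * (C1 * E0) * r `^ kap by ring.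
    by rewrite ler_wpM2l// (le_trans gr)// lerD// ler_wpM2l.
  have -> : `|h| / r * ((2 + C2 * C1) * E0 * r `^ kap) =
    (2 + C2 * C1) * (E0 * (`|h| / r * r `^ kap)) by ring.
  by rewrite ler_wpM2l ?addr_ge0 ?mulr_ge0// ler_wpM2l.
rewrite (le_trans (ler_normB _ _))//.
have E1 : (2 + C2 * C1) * (E0 * W) = 2 * (E0 * W) + C2 * C1 * (E0 * W) by ring.
by have := far hr; rewrite E1 in gh; lra.
Qed.

End holder_spaces.

(** * From differences to Hoelder seminorms *)

Section a_priori.
Context {R : realType} {d : nat}.
Local Notation V := 'rV[R]_d.
Local Notation mu := (lebesgue_rV R d).
Implicit Types (g u : V -> R) (k x y h : V) (ks : seq V) (j : seq 'I_d).

(** The differences of order [m] of [fdiff k u] at scale [t <= `|k|] are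
    [O (t ^ m * `|k| `^ (gam - m))] by Marchaud's critical inequality, hence so
    are its derivatives of order [m] after division by [t ^ m]. *)
Lemma holder_seminorm_fdiffs m (gam : R) : m%:R < gam ->
  exists2 C : R, 0 <= C & forall u (Z H : R), 0 <= Z -> 0 <= H ->
  times_differentiable m u ->
  (forall j, size j = m -> forall x h,
    `|iter_partial j u (x + h) - iter_partial j u x| <= H * `|h| `^ (gam - m%:R)) ->
  (forall t : R, 0 < t -> fdiffs_bounded m.+1 t (Z * t `^ gam) u) ->
  forall j, size j = m ->
  (holder_seminorm (gam - m%:R) (iter_partial j u) <= (C * Z)%:E)%E.
Proof.
move=> mg; have th0 : 0 < gam - m%:R by rewrite subr_gt0.
have [C C0 CP] := @marchaud_critical R V m gam mg.
exists (C * 2); first by rewrite mulr_ge0.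
move=> u Z H Z0 H0 du uH uZ j sj; apply: holder_seminorm_le => x k.
apply: (@le_trans _ _ (C * 2 * Z * `|k| `^ (gam - m%:R))); last first.
  by rewrite ler_wpM2l ?mulr_ge0// powR_enorm_ge// ltW.
have [->|k0] := eqVneq k 0.
  by rewrite addr0 subrr !normr0 powR0 ?mulr0// gt_eqF.
have r0 : 0 < `|k| by rewrite normr_gt0.
rewrite -[X in `|X|]/(fdiff k (iter_partial j u) x) -iter_partial_fdiff ?sj//.
have uk n t B : fdiffs_bounded n t B u -> fdiffs_bounded n t (2 * B) (fdiff k u).
  move=> uB ks y sks wks; rewrite fdiffs_fdiff /fdiff.
  by rewrite mulr2n mulrDl mul1r (le_trans (ler_normB _ _))// lerD// uB.
apply: (@iter_partial_le R d j (fdiff k u) x (2 * H) (gam - m%:R) _ `|k|) => //.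
- by rewrite mulr_ge0.
- by rewrite sj; exact: times_differentiable_fdiff.
- move=> y h; rewrite iter_partial_fdiff ?sj// /fdiff.
  have -> (a b c e : R) : a - b - (c - e) = (a - c) - (b - e) by ring.
  rewrite -mulrA mulr2n mulrDl mul1r (le_trans (ler_normB _ _))// lerD ?uH//.
  by rewrite addrAC uH.
rewrite sj => t tk.
have := @CP (fdiff k u) (2 * Z) `|k|.
rewrite mulr_ge0// => /(_ isT r0) h.
have : fdiffs_bounded m t (C * (2 * Z) * `|k| `^ (gam - m%:R) * t ^+ m) (fdiff k u).
  apply: h => //.
    by move=> s /andP[s0 _]; rewrite -mulrA; apply: uk; exact: uZ.
  move=> ks y sks wks.
  apply: (@le_trans _ _ (Z * `|k| `^ gam)).
    by rewrite fdiffs_fdiff; apply: (uZ _ r0 (k :: ks)); rewrite /= ?sks// lexx.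
  by rewrite -mulrA ler_peMl ?mulr_ge0 ?powR_ge0// ler1n.
by rewrite mulrA.
Qed.

(** The least constant, with near-extremal increments; the scale [r] at which
    these occur is the one where the maximum principle is applied. *)
Lemma fdiffs_sup N (gam Z0 : R) u : 0 <= Z0 ->
  (forall t : R, 0 < t -> fdiffs_bounded N t (Z0 * t `^ gam) u) ->
  exists2 Z : R, 0 <= Z & (forall t : R, 0 < t -> fdiffs_bounded N t (Z * t `^ gam) u) /\
  (forall c : R, c < 1 -> 0 < Z -> exists r ks x,
     [/\ 0 < r, size ks = N, bounded_by r ks & c * (Z * r `^ gam) <= `|fdiffs ks u x|]).
Proof.
move=> Z00 uZ.
pose S : set R := [set z | exists r ks x, [/\ 0 < r, size ks = N, bounded_by r ks &
   z = `|fdiffs ks u x| / r `^ gam]].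
have supS : has_sup S.
  split.
    exists (`|fdiffs (nseq N 0) u 0| / 1 `^ gam); exists 1, (nseq N 0), 0.
    split; rewrite ?size_nseq//.
    by apply/allP => y /nseqP[-> _]; rewrite normr0.
  exists Z0 => _ [r [ks [x [r0 sks wks ->]]]].
  by rewrite ler_pdivrMr ?powR_gt0// uZ.
have SZ r ks x : 0 < r -> size ks = N -> bounded_by r ks ->
    `|fdiffs ks u x| <= sup S * r `^ gam.
  move=> r0 sks wks; rewrite -ler_pdivrMr ?powR_gt0//.
  by apply: sup_upper_bound => //; exists r, ks, x.
exists (sup S).
  have := SZ 1 (nseq N 0) 0 ltr01; rewrite size_nseq powR1 mulr1 => h.
  apply: le_trans (h _ _) => //.
  by apply/allP => y /nseqP[-> _]; rewrite normr0.
split=> [t t0 ks x sks wks|c c1 S0]; first exact: SZ.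
have e0 : 0 < (1 - c) * sup S by rewrite mulr_gt0// subr_gt0.
have [_ [r [ks [x [r0 sks wks ->]]]] h] := sup_adherent e0 supS.
exists r, ks, x; split=> //.
rewrite mulrA -ler_pdivlMr ?powR_gt0//; apply: ltW; apply: le_lt_trans h.
by rewrite le_eqVlt; apply/orP; left; apply/eqP; ring.
Qed.

Lemma stable_like_opE (alpha : R) A u x : stable_like_op alpha A u x =
  \int[mu]_(h in [set h | h != 0])
    (increment (1 <= alpha) u (grad_dot u) x h *
     (A x h / enorm h `^ (d%:R + alpha))).
Proof.
rewrite /stable_like_op /increment; case: ifP => // _.
by apply: eq_Rintegral => h _; rewrite mul0r subr0.
Qed.

(** Two exponents above [alpha]: integrability needs the lower one, and the gap
    to the upper one makes the increments of an almost maximum small near the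
    origin relatively to the lower weight. *)
Lemma intermediate_exponents (alpha gam : R) :
  0 < alpha < 2 -> alpha < gam -> exists kap' kap : R,
  [/\ alpha < kap', kap' < kap, kap <= gam &
     if 1 <= alpha then (1 < kap') && (kap < 2) else kap < 1].
Proof.
move=> /andP[a0 a2] ag.
pose s := Num.min gam (if 1 <= alpha then 2 else 1).
have as' : alpha < s.
  by rewrite lt_min ag /=; case: ifP => // /negbT; rewrite -ltNge.
have sg : s <= gam by rewrite ge_min lexx.
have s2 : s <= if 1 <= alpha then 2 else 1 by rewrite ge_min lexx orbT.
exists (alpha + (s - alpha) / 3), (alpha + 2 * (s - alpha) / 3); split; try lra.
by move: s2; case: ifP => a1 s2; lra.
Qed.

Lemma grad_dotZ u y h (c : R) : grad_dot u y (c *: h) = c * grad_dot u y h.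
Proof.
by rewrite /grad_dot mulr_sumr; apply: eq_bigr => i _; rewrite mxE mulrCA.
Qed.

Lemma times_differentiable_continuous m (H theta : R) u : 0 <= H -> 0 < theta ->
  times_differentiable m u ->
  (forall j, size j = m -> forall x h,
    `|iter_partial j u (x + h) - iter_partial j u x| <= H * `|h| `^ theta) ->
  continuous u.
Proof.
move=> H0 th0; case: m => [_ /(_ [::] erefl)|m [du _] _].
  exact: holder_continuous.
by move=> x; apply: differentiable_continuous; exact: du.
Qed.

End a_priori.

(** * Schauder estimate *)

Section schauder.
Context {R : realType} {d : nat}.
Local Notation V := 'rV[R]_d.
Local Notation mu := (lebesgue_rV R d).
Implicit Types (g u : V -> R) (k x y h : V) (ks : seq V) (j : seq 'I_d).

Lemma holder_mul_le (beta N0 s M : R) (P : V -> R) u :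
  0 <= beta -> 0 <= N0 -> 0 <= M ->
  (forall x, `|P x| <= N0) -> (forall x, `|u x| <= M) ->
  (forall x h, `|P (x + h) - P x| <= N0 * enorm h `^ beta) ->
  (forall x h, `|u (x + h) - u x| <= s * `|h| `^ beta) ->
  forall x h, `|P (x + h) * u (x + h) - P x * u x| <=
    (N0 * s + N0 * d.+1%:R `^ beta * M) * `|h| `^ beta.
Proof.
move=> b0 N00 M0 PN uM PH uH x h.
have -> : P (x + h) * u (x + h) - P x * u x =
  P (x + h) * (u (x + h) - u x) + (P (x + h) - P x) * u x by ring.
rewrite (le_trans (ler_normD _ _))// [leRHS]mulrDl !normrM lerD//.
  by rewrite -mulrA ler_pM.
rewrite -!mulrA (mulrC M) !mulrA ler_pM//.
apply: le_trans (PH x h) _; rewrite -mulrA ler_wpM2l//.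
exact: enorm_powR_le.
Qed.

(** The scale [r] of the interpolation is chosen from the constants alone, so
    small that the terms in [Z] coming from [P * u] and from the oscillation of
    the coefficients are at most half of [Z] together. *)
Lemma schauder_estimate (alpha beta : R) (A : V -> V -> R) (a1 a2 a3 N0 : R) :
  let gam := alpha + beta in let m := Num.truncn gam in
  (0 < d)%N -> 0 < alpha < 2 -> 0 < beta < 1 -> m%:R < gam ->
  measurable_fun [set: V * V] (fun z : V * V => A z.1 z.2) ->
  0 < a1 -> 0 < a2 -> 0 < a3 ->
  (forall x h, a1 <= A x h <= a2) ->
  (forall k x h, `|A (x + k) h - A x h| <= a3 * enorm k `^ beta) ->
  0 <= N0 ->
  exists2 X : R, 0 <= X & forall (P u f : V -> R) (M s H0 : R),
  0 <= M -> 0 <= s -> 0 <= H0 ->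
  (forall x, `|P x| <= N0) ->
  (forall x h, `|P (x + h) - P x| <= N0 * enorm h `^ beta) ->
  (forall x, `|u x| <= M) ->
  times_differentiable m u ->
  (forall j, size j = m -> forall x h,
    `|iter_partial j u (x + h) - iter_partial j u x| <= H0 * `|h| `^ (gam - m%:R)) ->
  (forall x h, `|f (x + h) - f x| <= s * enorm h `^ beta) ->
  (forall x, stable_like_op alpha A u x + P x * u x = f x) ->
  forall j, size j = m ->
  (holder_seminorm (gam - m%:R) (iter_partial j u) <= (X * (M + s))%:E)%E.
Proof.
move=> gam m hd al be mg mA a10 a20 a30 hA hAh N00.
have [al0 al2] := andP al; have [be0 be1] := andP be.
have ag : alpha < gam by rewrite ltrDl.
have gam0 : 0 < gam by rewrite addr_gt0.
have gm1 : gam < m.+1%:R by have /andP[] := truncn_itv (ltW gam0).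
have [kap' [kap [alk kk' kg kc]]] := intermediate_exponents al ag.
have k'0 : 0 < kap' by apply: lt_trans alk.
have kap0 : 0 < kap by apply: lt_trans kk'.
have [C1 C10 C1P] := @fdiffs_estimate R d alpha beta kap' a1 a2 a3 m.+1 hd
  (introT andP (conj al0 alk)) be0 isT gm1 a10 a20 a30.
have comp_m : 1 <= alpha -> (1 < m.+1)%N.
  by move=> a1'; rewrite -(ltr_nat R) (lt_trans _ gm1)// (le_lt_trans a1').
have [C2 C20 C2P] : exists2 C : R, 0 <= C & forall u (M Z r : R),
    0 <= M -> 0 <= Z -> 0 < r <= 1 -> (forall x, `|u x| <= M) ->
    (1 <= alpha -> forall y, differentiable u y) ->
    (forall t : R, 0 < t -> fdiffs_bounded m.+1 t (Z * t `^ gam) u) ->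
    forall y h, `|increment (1 <= alpha) u (grad_dot u) y h| <=
    C * (Z * r `^ (gam - kap') + M * r `^ (- kap')) * Num.min 1 (`|h| `^ kap').
  apply: increment_interpolation; first by rewrite k'0 (le_trans (ltW kk')).
  case: (boolP (1 <= alpha)) kc => [a1' /andP[k1 k2]|_ k1] /=.
    by rewrite comp_m// k1 (lt_trans kk').
  by rewrite (lt_trans kk').
have [C3 C30 C3P] : exists2 C : R, 0 <= C & forall u (M Z r : R),
    0 <= M -> 0 <= Z -> 0 < r <= 1 -> (forall x, `|u x| <= M) ->
    (1 <= alpha -> forall y, differentiable u y) ->
    (forall t : R, 0 < t -> fdiffs_bounded m.+1 t (Z * t `^ gam) u) ->
    forall y h, `|increment (1 <= alpha) u (grad_dot u) y h| <=
    C * (Z * r `^ (gam - kap) + M * r `^ (- kap)) * Num.min 1 (`|h| `^ kap).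
  apply: increment_interpolation; first by rewrite kap0.
  case: (boolP (1 <= alpha)) kc => [a1' /andP[k1 k2]|_ k1] //=.
  by rewrite comp_m// (lt_trans k1).
have [C4 C40 C4P] := @increment_interpolation R d false m.+1 gam beta
  (introT andP (conj be0 (ltW (ltr_pwDl al0 (lexx beta))))) be1.
have [CG CG0 CGP] := @holder_seminorm_fdiffs R d m gam mg.
set Db : R := d.+1%:R `^ beta; have Db0 : 0 <= Db by exact: powR_ge0.
have gb : 0 < gam - beta by rewrite /gam addrK.
have gk : 0 < gam - kap' by rewrite subr_gt0 (lt_le_trans kk').
have K1 : 0 <= C1 * (N0 * C4) by rewrite !mulr_ge0.
have K2 : 0 <= C1 * C2 by rewrite mulr_ge0.
have q0 : 0 < 1 / 4 :> R by rewrite divr_gt0.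
have [t1 t10 t1P] := powR_small gb K1 q0.
have [t2 t20 t2P] := powR_small gk K2 q0.
have [r [r0 r1 rt1 rt2]] : exists r : R, [/\ 0 < r, r <= 1, r <= t1 & r <= t2].
  exists (Num.min 1 (Num.min t1 t2)).
  by rewrite !lt_min !ge_min !lexx ltr01 t10 t20 !orbT.
have {t1 t10 t1P rt1} S1 : C1 * (N0 * C4) * r `^ (gam - beta) <= 1 / 4.
  by apply: t1P; rewrite (ltW r0).
have {t2 t20 t2P rt2} S2 : C1 * C2 * r `^ (gam - kap') <= 1 / 4.
  by apply: t2P; rewrite (ltW r0).
pose Y := C1 * (N0 * C4 * r `^ (- beta) + N0 * Db + C2 * r `^ (- kap')).
have Y0 : 0 <= Y.
  by rewrite mulr_ge0// !addr_ge0// !mulr_ge0 ?powR_ge0.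
exists (CG * (2 * (C1 * Db + Y))).
  by rewrite mulr_ge0// mulr_ge0// addr_ge0// mulr_ge0.
move=> P u f M s H0 M0 s0 H00 PN PH uM du uH fH Lu j sj.
have th0 : 0 < gam - m%:R by rewrite subr_gt0.
have cu : continuous u := times_differentiable_continuous H00 th0 du uH.
have du1 : 1 <= alpha -> forall y, differentiable u y.
  by move=> /comp_m; rewrite ltnS => m0; move: du; rewrite -(prednK m0) => -[].
have r01 : 0 < r <= 1 by rewrite r0.
have [Z Z0 [uZ Zsup]] : exists2 Z : R, 0 <= Z &
    (forall t : R, 0 < t -> fdiffs_bounded m.+1 t (Z * t `^ gam) u) /\
    (forall c : R, c < 1 -> 0 < Z -> exists r ks x,
     [/\ 0 < r, size ks = m.+1, bounded_by r ks & c * (Z * r `^ gam) <= `|fdiffs ks u x|]).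
  apply: (@fdiffs_sup R d m.+1 gam (d%:R ^+ m * H0)).
    by rewrite mulr_ge0 ?exprn_ge0.
  move=> t t0.
  have -> : d%:R ^+ m * H0 * t `^ gam = d%:R ^+ m * H0 * t ^+ m * t `^ (gam - m%:R).
    rewrite -[RHS]mulrA -(@powR_mulrn _ t) ?(ltW t0)// -powRD ?(gt_eqF t0) ?implybT//.
    by rewrite addrC subrK.
  by apply: holder_fdiffs => //; exact: ltW.
apply: le_trans (CGP u Z H0 Z0 H00 du uH uZ j sj) _.
rewrite lee_fin -!mulrA ler_wpM2l//.
have [->|Zn0] := eqVneq Z 0.
  by rewrite mulr_ge0// mulr_ge0 ?addr_ge0// mulr_ge0.
have Zp : 0 < Z by rewrite lt_neqAle eq_sym Zn0.
have lam1 : (1 + 2 `^ (gam - m.+1%:R)) / 2 < 1 :> R.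
  have : 2 `^ (gam - m.+1%:R) < 2 `^ 0 :> R.
    by rewrite gt1_ltr_powR ?ltr1n// subr_lt0.
  by rewrite powRr0; lra.
have [rr [ks [x [rr0 sks wks ksx]]]] := Zsup _ lam1 Zp.
(* The one-sided estimate is applied to [u] or to its opposite. *)
have [sg [sg1 sgE]] : exists sg : R, `|sg| = 1 /\ sg * fdiffs ks u x = `|fdiffs ks u x|.
  have [h|h] := leP 0 (fdiffs ks u x).
    by exists 1; rewrite normr1 mul1r ger0_norm.
  by exists (-1); rewrite normrN1 mulN1r ltr0_norm.
pose E := C2 * (Z * r `^ (gam - kap') + M * r `^ (- kap')).
pose E2 := C3 * (Z * r `^ (gam - kap) + M * r `^ (- kap)).
have E0 : 0 <= E by rewrite mulr_ge0// addr_ge0// mulr_ge0// powR_ge0.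
have E20 : 0 <= E2 by rewrite mulr_ge0// addr_ge0// mulr_ge0// powR_ge0.
pose U := C4 * (Z * r `^ (gam - beta) + M * r `^ (- beta)).
have U0 : 0 <= U by rewrite mulr_ge0// addr_ge0// mulr_ge0// powR_ge0.
have uU y h : `|u (y + h) - u y| <= U * `|h| `^ beta.
  have := C4P u M Z r M0 Z0 r01 uM (fun c => False_ind _ (notF c)) uZ y h.
  rewrite /increment mul0r subr0 => /le_trans; apply.
  by rewrite ler_wpM2l// ge_min lexx orbT.
pose H := Db * s + (N0 * U + N0 * Db * M).
have HH0 : 0 <= H.
  exact: addr_ge0 (mulr_ge0 Db0 s0) (addr_ge0 (mulr_ge0 N00 U0) (mulr_ge0 (mulr_ge0 N00 Db0) M0)).
have Lf y k : `|stable_like_op alpha A u (y + k) - stable_like_op alpha A u y| <=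
    H * `|k| `^ beta.
  have -> : stable_like_op alpha A u (y + k) - stable_like_op alpha A u y =
    (f (y + k) - f y) - (P (y + k) * u (y + k) - P y * u y).
    by rewrite -!Lu; ring.
  rewrite (le_trans (ler_normB _ _))// /H mulrDl lerD//.
    apply: le_trans (fH y k) _; rewrite (mulrC Db) -mulrA ler_wpM2l//.
    by rewrite enorm_powR_le// ltW.
  exact: holder_mul_le (ltW be0) N00 M0 PN uM PH uU y k.
pose p y h := sg * grad_dot u y h.
have incE y h : increment (1 <= alpha) (fun z => sg * u z) p y h =
    sg * increment (1 <= alpha) u (grad_dot u) y h.
  by rewrite /increment /p; ring.
have minc y : measurable_fun setT (increment (1 <= alpha) u (grad_dot u) y).
  apply: measurable_funB; last apply: measurable_funM.
  - apply: measurable_funB => //.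
    apply: (continuous_measurable_rV (u := fun h => u (y + h))) => z.
    apply: (@continuous_comp _ _ _ (fun h => y + h) u); last exact: cu.
    by apply: continuousD; [exact: cst_continuous|exact: cvg_id].
  - rewrite (_ : (fun h => _) = fun h => (1 <= alpha)%R%:R * \1_[set h : V | enorm h <= 1] h).
      apply: measurable_funM => //; apply: measurable_indic.
      rewrite (_ : [set h | _] = (@enorm R d) @^-1` `]-oo, 1]%classic).
        by rewrite -[X in measurable X]setTI; exact: measurable_enorm.
      by apply/seteqP; split => h /=; rewrite in_itv.
    apply/funext => h; rewrite indicE mem_setE -natrM mulnb.
    by congr ((_ && _)%:R); rewrite inE.
  - exact: measurable_grad_dot.
have mAx y : measurable_fun setT (A y).
  exact: (measurable_fun_pair2 (f := fun z => A z.1 z.2)).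
have An y h : `|A y h| <= a2.
  have /andP[h1 h2] := hA y h; rewrite ger0_norm// ltW//.
  exact: lt_le_trans h1.
have incZ y : sg * stable_like_op alpha A u y = \int[mu]_(h in [set h | h != 0])
    (increment (1 <= alpha) (fun z => sg * u z) p y h *
     (A y h / enorm h `^ (d%:R + alpha))).
  rewrite stable_like_opE.
  have [iy _] := kernel_integrable (introT andP (conj al0 alk)) E0 (minc y) (mAx y)
    (fun h _ => C2P u M Z r M0 Z0 r01 uM du1 uZ y h)
    (An y).
  rewrite -RintegralZl//; last exact: measurable_neq0_rV.
  by apply: eq_Rintegral => h _; rewrite incE mulrA.
have sgn (z : R) : `|sg * z| = `|z| by rewrite normrM sg1 mul1r.
have Zle : Z <= C1 * (H + E).
  apply: (C1P A (1 <= alpha) (fun z => sg * u z) (fun y => sg * stable_like_op alpha A u y)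
    p kap E E2 H Z rr ks x) => //.
  - by move=> a1'; move: kc; rewrite a1' => /andP[k1 _]; exact: lt_trans kk'.
  - move=> y; rewrite (_ : increment _ _ _ _ = fun h => sg *
      increment (1 <= alpha) u (grad_dot u) y h).
      exact: measurable_funM.
    by apply/funext => h; exact: incE.
  - by move=> y h c; rewrite /p grad_dotZ mulrCA.
  - by move=> y h _; rewrite incE sgn; exact: C2P.
  - by move=> y h _; rewrite incE sgn; exact: C3P.
  - by move=> t t0 ls y sls wls; rewrite fdiffsZ sgn; exact: uZ.
  - by move=> y k; rewrite -mulrBr sgn; exact: Lf.
  - by rewrite fdiffsZ sgE.
have : C1 * (H + E) = C1 * Db * s + C1 * (N0 * C4) * r `^ (gam - beta) * Z +
    C1 * C2 * r `^ (gam - kap') * Z + Y * M.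
  by rewrite /H /U /E /Y; ring.
have ZS1 := ler_wpM2r Z0 S1; have ZS2 := ler_wpM2r Z0 S2.
have CDs : 0 <= C1 * Db * M by rewrite !mulr_ge0.
have YS : 0 <= Y * s by rewrite mulr_ge0.
lra.
Qed.

End schauder.

Unset Implicit Arguments.

Theorem theorem7p1 (R : realType) (d : nat) (hd : (1 <= d)%N)
    (alpha beta : R)
    (halpha : 0 < alpha < 2) (hbeta : 0 < beta < 1)
    (hab : alpha + beta \isn't a Num.int)
    (A : 'rV[R]_d -> 'rV[R]_d -> R)
    (hAmeas : measurable_fun [set: 'rV[R]_d * 'rV[R]_d]
                (fun z : 'rV[R]_d * 'rV[R]_d => A z.1 z.2))
    (a1 a2 a3 : R) (ha1 : 0 < a1) (ha2 : 0 < a2) (ha3 : 0 < a3)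
    (hAbnd : forall x h : 'rV[R]_d, a1 <= A x h <= a2)
    (hAhold : forall k x h : 'rV[R]_d,
       `|A (x + k) h - A x h| <= a3 * enorm k `^ beta)
    (N : R) :
  exists c1 : R,
    forall P : 'rV[R]_d -> R, holder_norm beta P = N%:E ->
    forall u f : 'rV[R]_d -> R,
      holder_space (alpha + beta) u ->
      (forall x, stable_like_op alpha A u x + P x * u x = f x) ->
      (holder_norm (alpha + beta) u
        <= c1%:E * (Linfty_norm u + holder_norm beta f))%E.
Proof.
have [al0 al2] := andP halpha; have [be0 be1] := andP hbeta.
set gam := alpha + beta; set m := Num.truncn gam.
have gam0 : 0 < gam by rewrite addr_gt0.
have mg : m%:R < gam.
  rewrite lt_neqAle; have /andP[-> _] := truncn_itv (ltW gam0).
  rewrite andbT; apply: contraNneq hab => mE.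
  by rewrite -/gam -mE natr_int.
have th0 : 0 < gam - m%:R by rewrite subr_gt0.
have [X X0 XP] := schauder_estimate (N0 := `|N|) hd halpha hbeta mg hAmeas
  ha1 ha2 ha3 hAbnd hAhold (normr_ge0 N).
set T : R := #|{: m.-tuple 'I_d}|%:R.
exists (1 + T * X) => P PN u f [du unorm] Lu.
have T0 : 0 <= T by exact: ler0n.
have C0 : 0 < 1 + T * X by rewrite ltr_pwDl// mulr_ge0.
have Lu0 := Linfty_norm_ge0 u.
have Lf0 := Linfty_norm_ge0 f.
have [M M0 ME] : exists2 M : R, 0 <= M & Linfty_norm u = M%:E.
  have uoo : (Linfty_norm u < +oo)%E.
    exact: le_lt_trans (Linfty_le_holder_norm gam u hd) unorm.
  exists (fine (Linfty_norm u)); first exact: fine_ge0.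
  by rewrite fineK// ge0_fin_numE.
have nf0 : (0 <= holder_norm beta f)%E.
  exact: le_trans Lf0 (Linfty_le_holder_norm beta f hd).
have [foo|foo] := eqVneq (holder_norm beta f) +oo%E.
  by rewrite foo addeC addye ?ME// gt0_muley ?lte_fin// leey.
have nfE : holder_norm beta f \is a fin_num.
  by rewrite ge0_fin_numE// ltey.
set s := fine (holder_norm beta f).
have s0 : 0 <= s by exact: fine_ge0.
have fH := holder_seminorm_fin be0 (g := f) (s := s).
have {}fH : forall x h, `|f (x + h) - f x| <= s * enorm h `^ beta.
  by apply: fH; rewrite /s fineK//; exact: holder_seminorm_lt1.
have PNle : (holder_norm beta P <= `|N|%:E)%E by rewrite PN lee_fin ler_norm.
have PH : forall x h, `|P (x + h) - P x| <= `|N| * enorm h `^ beta.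
  apply: holder_seminorm_fin => //; apply: le_trans PNle.
  exact: holder_seminorm_lt1.
have cP : continuous P.
  apply: (@holder_continuous _ _ P (`|N| * d.+1%:R `^ beta) beta) => // x h.
  rewrite (le_trans (PH x h))// -mulrA ler_wpM2l//.
  by rewrite enorm_powR_le// ltW.
have Pb x : `|P x| <= `|N|.
  rewrite -lee_fin; apply: le_trans (continuous_le_Linfty x cP) _.
  by apply: le_trans PNle; exact: Linfty_le_holder_norm.
set H0 := fine (holder_norm gam u).
have nu0 : (0 <= holder_norm gam u)%E.
  exact: le_trans Lu0 (Linfty_le_holder_norm gam u hd).
have nuE : holder_norm gam u \is a fin_num by rewrite ge0_fin_numE.
have H00 : 0 <= H0 by exact: fine_ge0.
have uH (j : seq 'I_d) : size j = m -> forall x h,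
    `|iter_partial j u (x + h) - iter_partial j u x| <=
      H0 * d.+1%:R `^ (gam - m%:R) * `|h| `^ (gam - m%:R).
  move=> /eqP sj x h; rewrite -mulrA.
  apply: (@le_trans _ _ (H0 * enorm h `^ (gam - m%:R))).
    apply: holder_seminorm_fin => //; rewrite fineK//.
    exact: (holder_seminorm_le_norm u (Tuple sj) hd).
  by rewrite ler_wpM2l// enorm_powR_le// ltW.
have cu : continuous u.
  apply: times_differentiable_continuous th0 du uH.
  by rewrite mulr_ge0 ?powR_ge0.
have uM x : `|u x| <= M.
  by rewrite -lee_fin -ME; exact: continuous_le_Linfty.
have uX (j : m.-tuple 'I_d) :
    (holder_seminorm (gam - m%:R) (iter_partial j u) <= (X * (M + s))%:E)%E.
  apply: (XP P u f M s (H0 * d.+1%:R `^ (gam - m%:R))) => //.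
    by rewrite mulr_ge0 ?powR_ge0.
  by rewrite size_tuple.
rewrite -/gam {1}/holder_norm -/m ME -(fineK nfE) -/s.
apply: (@le_trans _ _ (M + T * (X * (M + s)))%:E).
  rewrite EFinD leeD//.
  apply: (@le_trans _ _ (\sum_(j : m.-tuple 'I_d) (X * (M + s))%:E)%E).
    by apply: lee_sum => j _; exact: uX.
  by rewrite sumEFin lee_fin sumr_const /T mulr_natl.
rewrite -EFinD -EFinM lee_fin mulrDl mul1r mulrA lerD2r.
by rewrite lerDl.
Qed.
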